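(* Let $X$ be a non-injective $C^*$-correspondence over a $C^*$-algebra $A$ (that is, $\ker\phi_X\neq(0)$), and let $X_\tau$ be a graph correspondence obtained from $X$ by adding a tail at the distinguished vertex $p_0$, as defined in the context, with underlying graph $\mathcal{G}=(\mathcal{G}^{(0)},\mathcal{G}^{(1)},r,s)$. Then $X_\tau$ is a Hilbert bimodule (equivalently, an essential Hilbert bimodule) if and only if $X$ is a Hilbert bimodule and $|s^{-1}(p)|=|r^{-1}(p)|=1$ for every vertex $p\neq p_0$ of $\mathcal{G}$.
   Context: A $B$-$C$-correspondence ($B,C$ $C^*$-algebras) is a right Hilbert $C$-module $Y$ with a $*$-homomorphism $\phi_Y\colon B\to\mathcal{L}(Y)$ into the adjointable operators; a $C^*$-correspondence over $A$ is an $A$-$A$-correspondence. $\mathcal{K}(Y)$ is the closed linear span of the operators $\Theta^Y_{\xi,\eta}(\zeta)=\xi\langle\eta,\zeta\rangle$. $Y$ is full if the closed linear span of $\{\langle\xi,\eta\rangle\}$ is $C$. $Y$ is a $B$-$C$-equivalence bimodule if it is full and $\phi_Y$ is a $*$-isomorphism of $B$ onto $\mathcal{K}(Y)$. For an ideal $I$ of $A$, $I^\perp=\{a\in A: ab=0\ \forall b\in I\}$. For a $C^*$-correspondence $X$ over $A$, $J_X=(\ker\phi_X)^\perp\cap\phi_X^{-1}(\mathcal{K}(X))$. A $C^*$-correspondence $X$ over $A$ is a Hilbert bimodule if it admits a left $A$-valued inner product $[\cdot,\cdot]_X$ (linear in the first variable, conjugate symmetric, positive, $[\phi_X(a)\xi,\eta]_X=a[\xi,\eta]_X$)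 with $\phi_X([\xi,\eta]_X)\zeta=\xi\langle\eta,\zeta\rangle_X$ for all $\xi,\eta,\zeta$. It is essential if $J_X$ is an essential ideal of $A$ (equivalently, for a Hilbert bimodule, $\phi_X$ is injective). Graph correspondences. Let $\mathcal{G}=(\mathcal{G}^{(0)},\mathcal{G}^{(1)},r,s)$ be a row-finite directed graph, i.e. $|r^{-1}(p)|<\infty$ for all $p\in\mathcal{G}^{(0)}$. Let $(A_p)_{p\in\mathcal{G}^{(0)}}$ be $C^*$-algebras and, for each edge $e$, let $X_e$ be an $A_{r(e)}$-$A_{s(e)}$-correspondence with left action $\phi_e$. Let $A_\mathcal{G}=c_0((A_p)_p)$ be the $c_0$-sum, and equip the finitely supported families $c_{00}((X_e)_e)$ with the $A_\mathcal{G}$-valued inner product $\langle u,v\rangle(p)=\sum_{s(e)=p}\langle u_e,v_e\rangle_{A_p}$. The completion $X_\mathcal{G}$ is a $C^*$-correspondence over $A_\mathcal{G}$ with $(ux)_e=u_ex_{s(e)}$ and $(\phi_\mathcal{G}(x)u)_e=\phi_e(x_{r(e)})(u_e)$. It is called the graph correspondence associated to $\{\mathcal{G},(A_p),(X_e)\}$. Adding a tail. A finite or infinite path is $f_1f_2\cdots$ with $s(f_i)=r(f_{i+1})$; its range is $r(f_1)$, and the source of a finite path $f_1\cdots f_n$ is $s(f_n)$. $X_\tau$ denotes any graph correspondence associated to data as follows. The row-finite graph $\mathcal{G}$ has a distinguished vertex $p_0$ with $A_{p_0}=A$ and a loop $e_0$ at $p_0$ with $X_{e_0}=X$; apart from $e_0$,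 no edge has source $p_0$. Let $\mathcal{G}'$ be $\mathcal{G}$ with the loop $e_0$ removed. Then $\mathcal{G}'$ is connected, has no sources (every vertex is the range of some edge of $\mathcal{G}'$), there is exactly one infinite path $w=e_1e_2e_3\cdots$ in $\mathcal{G}'$ with $r(w)=p_0$, and $\mathcal{G}'$ is $p_0$-accessible: for every vertex $p\neq p_0$ there is $n(p)\in\mathbb{N}$ such that every path $\ell$ of length $n(p)$ in $\mathcal{G}'$ with range $p$ has its source on $w$. Moreover: (i) for every edge $e\neq e_0,e_1$, $X_e$ is an $A_{r(e)}$-$A_{s(e)}$-equivalence bimodule; (ii) writing $X_1=X_{e_1}$ and $A_1=A_{s(e_1)}$, $X_1$ is a full right Hilbert $A_1$-module, $\mathcal{K}(X_1)\subseteq\phi_{X_1}(A)$, $J_X\subseteq\ker\phi_{X_1}\subseteq(\ker\phi_X)^\perp$, and $\phi_{X_1}^{-1}(\mathcal{K}(X_1))\subseteq\phi_X^{-1}(\mathcal{K}(X))$. *)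

(* Defs.v *)
From HB Require Import structures.
From Stdlib Require Import Relation_Operators.
From mathcomp Require Import all_boot all_order all_algebra.
From mathcomp Require Import complex ring.
From mathcomp Require Import boolp classical_sets functions cardinality fsbigop.
From mathcomp Require Import reals topology normedtype.

Set Implicit Arguments.
Unset Strict Implicit.
Unset Printing Implicit Defensive.

Import Order.TTheory GRing.Theory Num.Theory.
Import numFieldNormedType.Exports.

Local Open Scope classical_set_scope.
Local Open Scope ring_scope.

(* Scalars are R[i] for a realType R. The norm of a normedModType R[i] is
   R[i]-valued, and 0 < eps in R[i] forces eps to be real. C*-algebras are not
   assumed to be unital, hence are not pzRingTypes. *)
HB.mixin Record CompleteNormedModule_isCStarAlgebra (R : realType) A
    of CompleteNormedModule R[i] A := {
  cmul : A -> A -> A;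
  star : A -> A;
  cmulA : associative cmul;
  cmulDl : left_distributive cmul +%R;
  cmulDr : right_distributive cmul +%R;
  cscaleAl : forall (c : R[i]) (a b : A), c *: cmul a b = cmul (c *: a) b;
  cscaleAr : forall (c : R[i]) (a b : A), c *: cmul a b = cmul a (c *: b);
  starK : involutive star;
  starD : forall a b : A, star (a + b) = star a + star b;
  starZ : forall (c : R[i]) (a : A), star (c *: a) = c^* *: star a;
  starM : forall a b : A, star (cmul a b) = cmul (star b) (star a);
  cnormM : forall a b : A, `|cmul a b| <= `|a| * `|b|;
  cnorm_star : forall a : A, `|cmul (star a) a| = `|a| ^+ 2
}.

#[short(type="cstarAlgType")]
HB.structure Definition CStarAlgebra (R : realType) :=
  {A of CompleteNormedModule_isCStarAlgebra R A & CompleteNormedModule R[i] A}.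

Notation "a ** b" := (cmul a b) (at level 40, left associativity).

Section cstar_algebra.
Variables (R : realType) (A : cstarAlgType R).
Implicit Types (a b : A) (I J : set A).

Definition cpositive a : Prop := exists b, a = star b ** b.

Definition annihilator I : set A := [set a | forall b, I b -> a ** b = 0].

Definition closed_ideal I : Prop :=
  [/\ I 0,
      forall (c : R[i]) a b, I a -> I b -> I (c *: a + b),
      forall a b, I b -> I (a ** b),
      forall a b, I b -> I (b ** a) &
      closed I].

Definition essential_ideal J : Prop :=
  closed_ideal J /\
  forall I, closed_ideal I -> I <> [set 0] -> I `&` J <> [set 0].

Fact norm_star a : `|star a| = `|a|.
Proof.
suff le_norm b : `|b| <= `|star b|.
  by apply/eqP; rewrite eq_le le_norm -{2}(starK a) le_norm.
have [->|b0] := eqVneq b 0; first by rewrite normr0.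
rewrite -(ler_pM2r (_ : 0 < `|b|)) ?normr_gt0 // -expr2 -cnorm_star.
exact: cnormM.
Qed.

End cstar_algebra.

Definition lspan (K : pzRingType) (W : lmodType K) (S : set W) : set W :=
  [set x | exists n (c : 'I_n -> K) (y : 'I_n -> W),
     (forall i, S (y i)) /\ x = \sum_i c i *: y i].

HB.mixin Record CompleteNormedModule_isHilbertModule (R : realType)
    (C : cstarAlgType R) Y of CompleteNormedModule R[i] Y := {
  ract : Y -> C -> Y;
  inner : Y -> Y -> C;
  ractDl : forall (x y : Y) (a : C), ract (x + y) a = ract x a + ract y a;
  ractDr : forall (x : Y) (a b : C), ract x (a + b) = ract x a + ract x b;
  ractA : forall (x : Y) (a b : C), ract x (a ** b) = ract (ract x a) b;
  ractZl : forall (c : R[i]) (x : Y) (a : C), ract (c *: x) a = c *: ract x a;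
  ractZr : forall (c : R[i]) (x : Y) (a : C), ract x (c *: a) = c *: ract x a;
  innerPr : forall (c : R[i]) (x y z : Y),
    inner x (c *: y + z) = c *: inner x y + inner x z;
  inner_ract : forall (x y : Y) (a : C), inner x (ract y a) = inner x y ** a;
  inner_star : forall x y : Y, star (inner x y) = inner y x;
  inner_ge0 : forall x : Y, cpositive (inner x x);
  norm_inner : forall x : Y, `|x| ^+ 2 = `|inner x x|
}.

#[short(type="hilbertModType")]
HB.structure Definition HilbertModule (R : realType) (C : cstarAlgType R) :=
  {Y of CompleteNormedModule_isHilbertModule R C Y &
        CompleteNormedModule R[i] Y}.

Section hilbert_module.
Variables (R : realType) (C : cstarAlgType R) (Y : hilbertModType C).

Definition is_adjoint (T S : Y -> Y) : Prop :=
  forall x y, inner (T x) y = inner x (S y) :> C.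

Definition adjointable : set (Y -> Y) := [set T | exists S, is_adjoint T S].

Definition theta (xi eta : Y) : Y -> Y :=
  fun zeta => ract xi (inner eta zeta : C).

Definition opnorm_closure (S : set (Y -> Y)) : set (Y -> Y) :=
  [set T | forall eps : R[i], 0 < eps ->
     exists2 T', S T' & forall zeta, `|T zeta - T' zeta| <= eps * `|zeta|].

Definition compact_ops : set (Y -> Y) :=
  adjointable `&`
  opnorm_closure (lspan [set T | exists xi eta, T = theta xi eta]).

Definition full_module : Prop :=
  closure (lspan [set c : C | exists xi eta : Y, c = inner xi eta]) = setT.

End hilbert_module.

Record correspondence (R : realType) (B C : cstarAlgType R) := Correspondence {
  corr_module :> hilbertModType C;
  lact : B -> corr_module -> corr_module;
  lactP : forall (c : R[i]) (a b : B), lact (c *: a + b) = c *: lact a + lact b;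
  lactM : forall a b : B, lact (a ** b) = lact a \o lact b;
  lact_star : forall a : B, is_adjoint (lact a) (lact (star a))
}.

Arguments lact {R B C} Y : rename.

Fact lact0 (R : realType) (B C : cstarAlgType R) (Y : correspondence B C)
  (b : B) : lact Y b 0 = 0.
Proof.
have inner0 (y : Y) : inner y 0 = 0 :> C.
  by have := @innerPr R C Y (-1) y 0 0; rewrite scaler0 addr0 scaleN1r addNr.
have star0 : star 0 = 0 :> C.
  by have := starZ 0 (0 : C); rewrite rmorph0 !scale0r.
apply/eqP; rewrite -normr_eq0 -sqrf_eq0 (@norm_inner R C Y) lact_star -(@inner_star R C Y).
by rewrite inner0 star0 normr0.
Qed.

(* Transport of Y along equalities of its coefficient algebras. *)
Definition corr_cast (R : realType) (B B' C C' : cstarAlgType R)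
    (hB : B = B') (hC : C = C') (Y : correspondence B C) :
    correspondence B' C' :=
  let: erefl := hB in let: erefl := hC in Y.

Section correspondence_theory.
Variables (R : realType) (B C : cstarAlgType R) (Y : correspondence B C).

Definition lker : set B := [set b | lact Y b = 0].

Definition lact_compact : set B := lact Y @^-1` @compact_ops R C Y.

Definition equivalence_bimodule : Prop :=
  [/\ full_module Y, injective (lact Y) & range (lact Y) = @compact_ops R C Y].

Definition katsura_ideal : set B := annihilator lker `&` lact_compact.

End correspondence_theory.

Section hilbert_bimodule.
Variables (R : realType) (A : cstarAlgType R) (X : correspondence A A).

Definition hilbert_bimodule : Prop :=
  exists linner : X -> X -> A,
  [/\ forall (c : R[i]) x y z,
        linner (c *: x + y) z = c *: linner x z + linner y z,
      forall x y, star (linner x y) = linner y x,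
      forall x, cpositive (linner x x),
      forall a x y, linner (lact X a x) y = a ** linner x y &
      forall x y z, lact X (linner x y) z = ract x (inner y z : A)].

Definition essential_hilbert_bimodule : Prop :=
  hilbert_bimodule /\ essential_ideal (katsura_ideal X).

End hilbert_bimodule.

Definition family (I : Type) (M : I -> Type) : Type := forall i, M i.

HB.instance Definition _ (I : Type) (M : I -> choiceType) :=
  Choice.copy (family M) (forall i, M i).

Section family_lmodule.
Variables (K : pzRingType) (I : Type) (M : I -> lmodType K).
Implicit Types f g h : family M.

Let add f g : family M := fun i => f i + g i.
Let opp f : family M := fun i => - f i.
Let zero : family M := fun i => 0.
Let scale (c : K) f : family M := fun i => c *: f i.

Let addA : associative add.
Proof. by move=> f g h; apply: functional_extensionality_dep => i; apply: addrA. Qed.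
Let addC : commutative add.
Proof. by move=> f g; apply: functional_extensionality_dep => i; apply: addrC. Qed.
Let add0 : left_id zero add.
Proof. by move=> f; apply: functional_extensionality_dep => i; apply: add0r. Qed.
Let addN : left_inverse zero opp add.
Proof. by move=> f; apply: functional_extensionality_dep => i; apply: addNr. Qed.

HB.instance Definition _ :=
  GRing.isZmodule.Build (family M) addA addC add0 addN.

Let scaleA c d f : scale c (scale d f) = scale (c * d) f.
Proof. by apply: functional_extensionality_dep => i; apply: scalerA. Qed.
Let scale1 : left_id 1 scale.
Proof. by move=> f; apply: functional_extensionality_dep => i; apply: scale1r. Qed.
Let scaleDr : right_distributive scale +%R.
Proof. by move=> c f g; apply: functional_extensionality_dep => i; apply: scalerDr. Qed.
Let scaleDl f : {morph scale^~ f : c d / c + d}.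
Proof. by move=> c d; apply: functional_extensionality_dep => i; apply: scalerDl. Qed.

HB.instance Definition _ :=
  GRing.Zmodule_isLmodule.Build K (family M) scaleA scale1 scaleDr scaleDl.

End family_lmodule.

Definition family_fun (I : Type) (M : I -> Type) (f : family M) :
  forall i, M i := f.
Coercion family_fun : family >-> Funclass.

Section c0_sum.
Variables (R : realType) (V : Type) (A : V -> cstarAlgType R).

Definition vanishing : {pred family A} := fun a =>
  `[< forall eps : R[i], 0 < eps -> finite_set [set p | eps <= `|a p|] >].

Fact vanishing_submod_closed : submod_closed vanishing.
Proof.
split=> [|c a b /asboolP va /asboolP vb]; apply/asboolP => eps eps0.
  rewrite (_ : [set _ | _] = set0) ?finite_set0 // -subset0 => p /=.
  by rewrite normr0 lt_geF.
have e2 : 0 < eps / 2 by rewrite divr_gt0.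
have c1 : 0 < `|c| + 1 by rewrite ltr_wpDl.
have ec : 0 < eps / 2 / (`|c| + 1) by rewrite divr_gt0.
apply: (@sub_finite_set _ _
  ([set p | eps / 2 / (`|c| + 1) <= `|a p|] `|` [set p | eps / 2 <= `|b p|])).
  move=> p /= le_eps.
  have nr (x : A p) : `|x| \is Num.real by rewrite ger0_real.
  have gr (x : R[i]) : 0 < x -> x \is Num.real by move=> ?; rewrite gtr0_real.
  case: (real_leP (gr _ ec) (nr (a p))) => [|lta]; [by left|right].
  rewrite real_leNgt ?(gr _ e2) ?nr //; apply/negP => ltb.
  move: le_eps; rewrite real_leNgt ?(gr _ eps0) ?nr // => /negP; apply.
  apply: (le_lt_trans (ler_normD _ _)); rewrite [ltRHS]splitr ler_ltD //.
  rewrite normrZ; move: lta; rewrite ltr_pdivlMr // => /ltW.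
  apply: le_trans; rewrite mulrC ler_wpM2l // lerDl //.
by rewrite finite_setU; split; [exact: va|exact: vb].
Qed.

HB.instance Definition _ :=
  GRing.isSubmodClosed.Build R[i] (family A) vanishing vanishing_submod_closed.

Record c0_sum := C0Sum {
  c0_val :> family A;
  c0_valP : c0_val \in vanishing
}.

HB.instance Definition _ := [isSub for c0_val].
HB.instance Definition _ := [Choice of c0_sum by <:].
HB.instance Definition _ := [SubChoice_isSubLmodule of c0_sum by <:].

Implicit Types (a b : c0_sum).

(* The c0-sum carries the supremum norm. *)
Definition c0_norm a : R[i] :=
  (sup (range (fun p => complex.Re `|a p|)))%:C%C.

Let c0_eq a b : (forall p, a p = b p) -> a = b.
Proof. by move=> ab; apply/val_inj/functional_extensionality_dep. Qed.

Let norm_Re (p : V) (x : A p) : (complex.Re `|x|)%:C%C = `|x|.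
Proof. by apply: RRe_real; rewrite ger0_real. Qed.

Let c0_bounded a : has_ubound (range (fun p => complex.Re `|a p|)).
Proof.
have /asboolP/(_ 1 ltr01) fin := c0_valP a.
have [s sE] := (finite_seqP _).1 (finite_image (fun p => complex.Re `|a p|) fin).
exists (1 + \sum_(x <- s) `|x|) => _ [p _ <-].
have sum0 (t : seq R) : 0 <= \sum_(x <- t) `|x| by apply: sumr_ge0.
have [le1|] := boolP (1 <= `|a p|).
  have : [set` s] (complex.Re `|a p|) by rewrite -sE; exists p.
  rewrite /= => /path.splitPr[s1 s2]; rewrite big_cat big_cons /=.
  rewrite [X in 1 + X]addrCA [leRHS]addrCA; apply: ler_wpDr; last exact: ler_norm.
  by rewrite !addr_ge0.
rewrite -real_ltNge ?real1 ?ger0_real // => /ltW.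
by rewrite -norm_Re -(RRe_real (real1 _)) lecR /= => /le_trans; apply; rewrite lerDl.
Qed.

Fact c0_norm_ub a p : `|a p| <= c0_norm a.
Proof.
by rewrite -norm_Re /c0_norm lecR; apply: ub_le_sup => //; exists p.
Qed.

Let c0_norm_void a : ~ inhabited V -> c0_norm a = 0.
Proof.
move=> noV; rewrite /c0_norm; set S := (X in sup X).
suff -> : S = set0 by rewrite sup0.
by rewrite -subset0 => x [p _ _]; case: noV.
Qed.

Fact c0_norm_ge0 a : 0 <= c0_norm a.
Proof.
have [[p]|noV] := pselect (inhabited V); first exact: le_trans (c0_norm_ub a p).
by rewrite c0_norm_void.
Qed.

Fact c0_norm_le a (M : R[i]) :
  0 <= M -> (forall p, `|a p| <= M) -> c0_norm a <= M.
Proof.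
move=> M0 aM; have [[p]|noV] := pselect (inhabited V); last first.
  by rewrite c0_norm_void.
rewrite -[leRHS]RRe_real ?ger0_real // lecR; apply: ge_sup.
  by exists (complex.Re `|a p|), p.
by move=> _ [q _ <-]; rewrite -lecR norm_Re RRe_real ?ger0_real.
Qed.

Let c0_normD a b : c0_norm (a + b) <= c0_norm a + c0_norm b.
Proof.
apply: c0_norm_le => [|p]; first by rewrite addr_ge0 ?c0_norm_ge0.
by apply: le_trans (ler_normD _ _) _; rewrite lerD ?c0_norm_ub.
Qed.

Let c0_normZ (c : R[i]) a : c0_norm (c *: a) = `|c| * c0_norm a.
Proof.
apply/eqP; rewrite eq_le; apply/andP; split.
  apply: c0_norm_le => [|p]; first by rewrite mulr_ge0 ?c0_norm_ge0.
  by rewrite [leLHS]normrZ ler_wpM2l ?c0_norm_ub.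
have [->|c0] := eqVneq c 0; first by rewrite normr0 mul0r c0_norm_ge0.
have nc : 0 < `|c| by rewrite normr_gt0.
rewrite mulrC -ler_pdivlMr //; apply: c0_norm_le => [|p].
  by rewrite divr_ge0 ?c0_norm_ge0.
rewrite ler_pdivlMr // mulrC -normrZ; exact: c0_norm_ub (c *: a) p.
Qed.

Let c0_norm_eq0 a : c0_norm a = 0 -> a = 0.
Proof.
move=> a0; apply: c0_eq => p; apply/normr0_eq0/eqP.
by rewrite eq_le normr_ge0 -a0 c0_norm_ub.
Qed.

HB.instance Definition _ :=
  Lmodule_isNormed.Build R[i] c0_sum c0_normD c0_normZ c0_norm_eq0.

Let c0_normE a : `|a| = c0_norm a. Proof. by []. Qed.

Let c0_norm_subr a b p : `|a p - b p| <= `|a - b|.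
Proof. by have := c0_norm_ub (a - b) p. Qed.

Let c0_complete (F : set_system c0_sum) :
  ProperFilter F -> cauchy F -> cvg F.
Proof.
move=> FF /(cauchyP F) Fc.
have cvg_at p : cvg ((fun a : c0_sum => a p) @ F).
  apply: cauchy_cvg; apply/cauchyP => e e0; have [x Fx] := Fc e e0.
  exists (x p); change (F [set y : c0_sum | ball (x p) e (y p)]).
  apply: filterS Fx => y; rewrite -!ball_normE /= => xy.
  by apply: le_lt_trans _ xy; exact: c0_norm_subr.
pose l : family A := fun p => lim ((fun a : c0_sum => a p) @ F).
have approx e : 0 < e ->
    exists2 x : c0_sum, F (ball x e) & forall p, `|x p - l p| <= e + e.
  move=> e0; have [x Fx] := Fc e e0; exists x => // p.
  have Fl : F [set y : c0_sum | `|l p - y p| < e].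
    by have /cvgrPdist_lt/(_ e e0) := cvg_at p.
  have [y [/= xy ly]] := filter_ex (filterI Fx Fl).
  rewrite (_ : x p - l p = (x p - y p) + (y p - l p)); last first.
    by rewrite addrA subrK.
  apply: le_trans (ler_normD _ _) _; rewrite lerD //; last by rewrite distrC ltW.
  move: xy; rewrite -ball_normE /= => /ltW; apply: le_trans.
  exact: c0_norm_subr.
have vl : l \in vanishing.
  apply/asboolP => eps eps0.
  have e4 : 0 < eps / 4 by rewrite divr_gt0.
  have [x _ xl] := approx _ e4.
  have e2 : eps - (eps / 4 + eps / 4) = eps / 2 by field.
  have /asboolP/(_ (eps / 2)) fin := c0_valP x.
  apply: sub_finite_set (fin _) => [p /= le_eps|]; last by rewrite divr_gt0.
  rewrite -e2 lerBlDr; apply: (le_trans le_eps).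
  rewrite (_ : l p = x p - (x p - l p)); last by rewrite subKr.
  by apply: le_trans (ler_normB _ _) _; rewrite lerD.
apply/cvg_ex; exists (C0Sum vl); apply/cvgrPdist_le => eps eps0.
have e4 : 0 < eps / 4 by rewrite divr_gt0.
have [x Fx xl] := approx _ e4; apply: filterS Fx => y.
rewrite -ball_normE /= => xy; rewrite c0_normE.
apply: c0_norm_le => [|p]; first exact: ltW.
rewrite (_ : (C0Sum vl - y) p = (x p - y p) - (x p - l p)); last first.
  by rewrite opprB [RHS]addrC [RHS]addrA subrK.
apply: le_trans (ler_normB _ _) _.
apply: (@le_trans _ _ (eps / 4 + (eps / 4 + eps / 4))).
  rewrite lerD //; apply: le_trans _ (ltW xy); exact: c0_norm_subr.
rewrite -subr_ge0 (_ : _ - _ = eps / 4) ?ltW //; by field.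
Qed.

HB.instance Definition _ := Uniform_isComplete.Build c0_sum c0_complete.

Let mul_vanishing a b : ((fun p => a p ** b p) : family A) \in vanishing.
Proof.
have b1 : 0 < c0_norm b + 1 by rewrite ltr_wpDl ?c0_norm_ge0.
apply/asboolP => eps eps0; have /asboolP fin := c0_valP a.
apply: sub_finite_set (fin (eps / (c0_norm b + 1)) _) => [p /= le_eps|].
  rewrite ler_pdivrMr //; apply: le_trans le_eps _.
  apply: le_trans (cnormM _ _) _; rewrite ler_wpM2l //.
  by apply: le_trans (c0_norm_ub b p) _; rewrite lerDl.
by rewrite divr_gt0.
Qed.

Let star_vanishing a : ((fun p => star (a p)) : family A) \in vanishing.
Proof.
apply/asboolP => eps eps0; have /asboolP/(_ _ eps0) := c0_valP a.
by apply: sub_finite_set => p /=; rewrite norm_star.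
Qed.

Let mul a b : c0_sum := C0Sum (mul_vanishing a b).
Let inv a : c0_sum := C0Sum (star_vanishing a).

Let mulA : associative mul.
Proof. by move=> a b c; apply: c0_eq => p; apply: cmulA. Qed.
Let mulDl : left_distributive mul +%R.
Proof. by move=> a b c; apply: c0_eq => p; apply: cmulDl. Qed.
Let mulDr : right_distributive mul +%R.
Proof. by move=> a b c; apply: c0_eq => p; apply: cmulDr. Qed.
Let scaleAl (c : R[i]) a b : c *: mul a b = mul (c *: a) b.
Proof. by apply: c0_eq => p; apply: cscaleAl. Qed.
Let scaleAr (c : R[i]) a b : c *: mul a b = mul a (c *: b).
Proof. by apply: c0_eq => p; apply: cscaleAr. Qed.
Let invK : involutive inv.
Proof. by move=> a; apply: c0_eq => p; apply: starK. Qed.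
Let invD a b : inv (a + b) = inv a + inv b.
Proof. by apply: c0_eq => p; apply: starD. Qed.
Let invZ (c : R[i]) a : inv (c *: a) = c^* *: inv a.
Proof. by apply: c0_eq => p; apply: starZ. Qed.
Let invM a b : inv (mul a b) = mul (inv b) (inv a).
Proof. by apply: c0_eq => p; apply: starM. Qed.

Let normM a b : `|mul a b| <= `|a| * `|b|.
Proof.
apply: c0_norm_le => [|p]; first by rewrite mulr_ge0.
by apply: le_trans (cnormM _ _) _; rewrite ler_pM ?c0_norm_ub.
Qed.

Let norm_inv a : `|mul (inv a) a| = `|a| ^+ 2.
Proof.
apply/eqP; rewrite eq_le; apply/andP; split.
  apply: c0_norm_le => [|p]; first by rewrite exprn_ge0.
  by rewrite [leLHS]cnorm_star lerXn2r ?nnegrE ?c0_norm_ub ?normr_ge0.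
rewrite -(sqrtCK `|mul (inv a) a|) lerXn2r ?nnegrE ?sqrtC_ge0 ?normr_ge0 //.
apply: c0_norm_le => [|p]; first by rewrite sqrtC_ge0.
rewrite -(@ler_pXn2r _ 2) ?nnegrE ?sqrtC_ge0 // sqrtCK -cnorm_star.
exact: c0_norm_ub (mul (inv a) a) p.
Qed.

HB.instance Definition _ := CompleteNormedModule_isCStarAlgebra.Build R c0_sum
  mulA mulDl mulDr scaleAl scaleAr invK invD invZ invM normM norm_inv.

End c0_sum.

Record digraph := Digraph {
  vertex : choiceType;
  edge : choiceType;
  rng : edge -> vertex;
  src : edge -> vertex
}.

Definition row_finite (G : digraph) : Prop :=
  forall p : vertex G, finite_set (rng (d := G) @^-1` [set p]).

Record graph_data (R : realType) := GraphData {
  graph :> digraph;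
  graph_row_finite : row_finite graph;
  valg : vertex graph -> cstarAlgType R;
  ecorr : forall e : edge graph, correspondence (valg (rng e)) (valg (src e))
}.

Section c00.
Variables (R : realType) (D : graph_data R).
Local Notation E := (edge D).

Definition graph_algebra : cstarAlgType R := c0_sum (@valg R D).

Definition finitely_supported : {pred family (@ecorr R D)} :=
  fun u => `[< finite_set [set e | u e != 0] >].

Fact finitely_supported_submod_closed : submod_closed finitely_supported.
Proof.
split=> [|c u v /asboolP fu /asboolP fv]; apply/asboolP.
  by rewrite (_ : [set _ | _] = set0) // -subset0 => e /=; rewrite eqxx.
have : finite_set ([set e | u e != 0] `|` [set e | v e != 0]).
  by rewrite finite_setU.
apply: sub_finite_set => e /=; have [u0|? _] := eqVneq (u e) 0; last by left.
have [v0|? _] := eqVneq (v e) 0; last by right.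
suff -> : (c *: u + v) e = 0 by rewrite eqxx.
by rewrite -[LHS]/(c *: u e + v e) u0 v0 scaler0 addr0.
Qed.

HB.instance Definition _ := GRing.isSubmodClosed.Build R[i]
  (family (@ecorr R D)) finitely_supported finitely_supported_submod_closed.

Record c00 := C00 {
  c00_val :> family (@ecorr R D);
  c00_valP : c00_val \in finitely_supported
}.

HB.instance Definition _ := [isSub for c00_val].
HB.instance Definition _ := [Choice of c00 by <:].
HB.instance Definition _ := [SubChoice_isSubLmodule of c00 by <:].

(* The value at p of <u, v>. Summands live in valg (src e), which is valg p
   only up to the equation src e = p, hence the extension by zero. *)
Definition graph_inner (u v : c00) (p : vertex D) : valg p :=
  \sum_(e \in src (d := D) @^-1` [set p])
    dfwith (fun q => 0 : valg q) (inner (u e) (v e)) p.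

Fact graph_ract_subproof (u : c00) (x : graph_algebra) :
  ((fun e => ract (u e) (x (src e))) : family (@ecorr R D))
    \in finitely_supported.
Proof.
apply/asboolP; have /asboolP := c00_valP u.
apply: sub_finite_set => e /=; apply: contra_neq; rewrite /family_fun => ->.
by have := ractZl 0 (0 : ecorr e) (x (src e)); rewrite !scale0r.
Qed.

Definition graph_ract (u : c00) (x : graph_algebra) : c00 :=
  C00 (graph_ract_subproof u x).

Fact graph_lact_subproof (x : graph_algebra) (u : c00) :
  ((fun e => lact (ecorr e) (x (rng e)) (u e)) : family (@ecorr R D))
    \in finitely_supported.
Proof.
apply/asboolP; have /asboolP := c00_valP u.
apply: sub_finite_set => e /=; apply: contra_neq; rewrite /family_fun => ->.
exact: lact0.
Qed.

Definition graph_lact (x : graph_algebra) (u : c00) : c00 :=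
  C00 (graph_lact_subproof x u).

(* Y is the completion of c00: it contains an isometric copy of c00 as a dense
   subspace, on which the two actions of Y are the coordinatewise ones. *)
Definition graph_correspondence
    (Y : correspondence graph_algebra graph_algebra) : Prop :=
  exists iota : {linear c00 -> Y},
  [/\ forall u v p, (inner (iota u) (iota v) : graph_algebra) p =
        graph_inner u v p,
      dense (range iota),
      forall u x, iota (graph_ract u x) = ract (iota u) x &
      forall x u, iota (graph_lact x u) = lact Y x (iota u)].

End c00.

Section digraph_theory.
Variable G : digraph.
Local Notation V := (vertex G).
Local Notation E := (edge G).

Definition connected_graph : Prop :=
  forall p q : V,
    clos_refl_sym_trans V (fun p q => exists e : E, rng e = p /\ src e = q) p q.

Definition no_sources : Prop := forall p : V, exists e : E, rng e = p.

Definition infinite_path (w : nat -> E) (p : V) : Prop :=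
  rng (w 0%N) = p /\ forall i, src (w i) = rng (w i.+1).

Definition on_path (w : nat -> E) (p : V) : Prop :=
  exists i, rng (w i) = p \/ src (w i) = p.

(* Finite paths with range p; the empty one has source p. *)
Fixpoint finite_path (p : V) (l : seq E) : Prop :=
  if l is e :: l' then rng e = p /\ finite_path (src e) l' else True.

Definition path_source (p : V) (l : seq E) : V := last p (map (@src G) l).

Definition accessible (w : nat -> E) (p0 : V) : Prop :=
  forall p, p <> p0 -> exists n, forall l,
    size l = n -> finite_path p l -> on_path w (path_source p l).

Definition remove_edge (e0 : E) : digraph :=
  @Digraph V {e : E | e != e0} (fun e => rng (val e)) (fun e => src (val e)).

End digraph_theory.

(* The infinite path e_1 e_2 e_3 ... is tail_path, indexed from 0. *)
Record tail_graph (R : realType) := TailGraph {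
  tail_data :> graph_data R;
  p0 : vertex tail_data;
  e0 : edge tail_data;
  rng_e0 : rng e0 = p0;
  src_e0 : src e0 = p0;
  src_p0 : forall e : edge tail_data, src e = p0 -> e = e0;
  tail_connected : connected_graph (remove_edge e0);
  tail_no_sources : no_sources (remove_edge e0);
  tail_path : nat -> edge (remove_edge e0);
  tail_pathP : infinite_path tail_path p0;
  tail_path_unique : forall w : nat -> edge (remove_edge e0),
    infinite_path w p0 -> w = tail_path;
  tail_accessible : accessible tail_path p0
}.
Arguments p0 {R} t.
Arguments e0 {R} t.

Definition e1 (R : realType) (T : tail_graph R) : edge T :=
  val (tail_path T 0%N).

Definition loop_corr (R : realType) (T : tail_graph R) :
    correspondence (valg (p0 T)) (valg (p0 T)) :=
  corr_cast (congr1 (@valg R T) (rng_e0 T)) (congr1 (@valg R T) (src_e0 T))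
    (ecorr (e0 T)).

Definition first_corr (R : realType) (T : tail_graph R) :
    correspondence (valg (p0 T)) (valg (src (e1 T))) :=
  corr_cast (congr1 (@valg R T) (proj1 (tail_pathP T))) erefl (ecorr (e1 T)).

Record tail (R : realType) (A : cstarAlgType R) (X : correspondence A A) :=
  Tail {
  tail_to_graph :> tail_graph R;
  valg_p0 : valg (p0 tail_to_graph) = A;
  ecorr_e0 : corr_cast valg_p0 valg_p0 (loop_corr tail_to_graph) = X;
  ecorr_equivalence : forall e : edge tail_to_graph,
    e <> e0 tail_to_graph -> e <> e1 tail_to_graph ->
    equivalence_bimodule (ecorr e);
  X1 := corr_cast valg_p0 erefl (first_corr tail_to_graph);
  X1_full : full_module X1;
  X1_compact : @compact_ops _ _ X1 `<=` range (lact X1);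
  X1_katsura : katsura_ideal X `<=` lker X1;
  X1_lker : lker X1 `<=` annihilator (lker X);
  X1_lact_compact : lact_compact X1 `<=` lact_compact X
}.

(* Main.v *)
From HB Require Import structures.
From mathcomp Require Import all_boot all_order all_algebra.
From mathcomp Require Import complex ring.
From mathcomp Require Import boolp classical_sets functions cardinality fsbigop.
From mathcomp Require Import reals topology normedtype.
Require Import Defs.

Set Implicit Arguments.
Unset Strict Implicit.
Unset Printing Implicit Defensive.

Import Order.TTheory GRing.Theory Num.Theory.
Import numFieldNormedType.Exports.

Local Open Scope classical_set_scope.
Local Open Scope ring_scope.

(** The conditions on a left inner product say that its value at (x, y) is an
    element a orthogonal to the kernel of the left action and acting as
    z |-> x <y, z>.  Such an a is unique if it exists (left_rep_uniq), and
    hilbert_bimoduleP reduces the property of being a Hilbert bimodule to the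
    existence of these representatives for all pairs of vectors.

    Two facts make this work.  First, |a| <= |x| |y| (left_rep_norm), so that
    representatives need only be found for a dense set of vectors
    (left_rep_dense).  This rests on rep_contractive: a selfadjoint c with
    |c| <= 1 satisfies c ^ 2 + (1 - b) ^ 2 = 1 for some b, hence acts as a
    contraction in every representation, even if this is not known to be
    continuous.  Secondly, the representative of (x, x) is positive
    (left_rep_positive): its cube is a square.  Positivity is studied through
    the condition |t - h| <= t, which provides square roots, and the positivity
    of d^* d in this sense is positive_star_mul.

    Let Y be the correspondence of a tail.  The left action of Y is injective
    (tail_lact_injective), so for a Hilbert bimodule Y the Katsura ideal is
    essential: if a moves z, then a [z, z] acts as an operator of rank one.

    If Y is a Hilbert bimodule, then the coordinate at p0 of its left inner
    product gives one on X (tail_loop_rep).  For edges e and f with the same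
    source, the representative of a pair of vectors on e and f acts diagonally
    on the edges and yet maps X_f to X_e; as X_f is full, X_e = 0 unless e = f
    (tail_src_inj).  By accessibility all the vertices are then on the tail, and
    uniqueness of the infinite path leaves one edge into each (line_graph).

    Conversely, suppose that X is a Hilbert bimodule and the graph is a line.
    It is enough to represent pairs of vectors supported on single edges.  On
    two different edges, which have different sources, 0 will do.  On an
    equivalence bimodule, operators of rank one are in the image of the action.
    On the loop the value given by X lies in the Katsura ideal and acts as zero
    on X1.  On the first edge, an operator of rank one is the action of some a,
    which must be corrected so that it acts as zero on X: as a acts on X by a
    compact operator, it agrees there with an element of the Katsura ideal
    (compact_lact_katsura), which is subtracted. *)

(** * Identities between linear combinations *)

Section linear_identities.
Variables (K : pzRingType) (V : lmodType K).

(** Reified linear combinations; LVar i is the i-th atom of an environment. *)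
Inductive lexpr :=
  LVar of nat | LZero | LAdd of lexpr & lexpr | LOpp of lexpr
| LScale of K & lexpr.

Fixpoint leval (env : seq V) (e : lexpr) : V :=
  match e with
  | LVar i => nth 0 env i
  | LZero => 0
  | LAdd e1 e2 => leval env e1 + leval env e2
  | LOpp e1 => - leval env e1
  | LScale c e1 => c *: leval env e1
  end.

Fixpoint lcoef (e : lexpr) (i : nat) : K :=
  match e with
  | LVar j => if eqn i j then 1 else 0
  | LZero => 0
  | LAdd e1 e2 => lcoef e1 i + lcoef e2 i
  | LOpp e1 => - lcoef e1 i
  | LScale c e1 => c * lcoef e1 i
  end.

Fixpoint lcoef_eq (e1 e2 : lexpr) (n : nat) : Prop :=
  if n is n'.+1 then lcoef e1 n' = lcoef e2 n' /\ lcoef_eq e1 e2 n' else True.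

Lemma leval_coef env e :
  leval env e = \sum_(i < size env) lcoef e i *: nth 0 env i.
Proof.
have eqnE i j : eqn i j = (i == j) by [].
elim: e => /= [j||e1 -> e2 ->|e ->|c e ->].
- have [lt_j|le_j] := ltnP j (size env).
    rewrite (bigD1 (Ordinal lt_j)) //= eqnE eqxx scale1r big1 ?addr0 // => i.
    by rewrite -val_eqE eqnE /= => /negPf ->; rewrite scale0r.
  rewrite nth_default // big1 // => i _; rewrite eqnE ltn_eqF ?scale0r //.
  exact: leq_trans (ltn_ord i) le_j.
- by rewrite big1 // => i _; rewrite scale0r.
- by rewrite -big_split; apply: eq_bigr => i _; rewrite scalerDl.
- by rewrite -sumrN; apply: eq_bigr => i _; rewrite scaleNr.
- by rewrite scaler_sumr; apply: eq_bigr => i _; rewrite scalerA.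
Qed.

Lemma leval_eq env e1 e2 :
  lcoef_eq e1 e2 (size env) -> leval env e1 = leval env e2.
Proof.
rewrite !leval_coef => e12; apply: eq_bigr => i _; congr (_ *: _).
have: (i < size env)%N by [].
move: (nat_of_ord i) => {i}; elim: (size env) e12 => //= n IHn [en /IHn e12] i.
by rewrite ltnS leq_eqVlt => /predU1P[->|/e12].
Qed.

End linear_identities.

Ltac lin_add t l :=
  match l with
  | context [cons t _] => l
  | _ => constr:(cons t l)
  end.
Ltac lin_atoms t l :=
  match t with
  | (?a + ?b)%R => let l := lin_atoms a l in lin_atoms b l
  | (- ?a)%R => lin_atoms a l
  | (_ *: ?a)%R => lin_atoms a l
  | 0%R => l
  | _ => lin_add t l
  end.
Ltac lin_index t l :=
  match l with
  | cons t _ => constr:(0%N)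
  | cons _ ?l' => let i := lin_index t l' in constr:(S i)
  end.
Ltac lin_reify K t l :=
  match t with
  | (?a + ?b)%R => let a' := lin_reify K a l in let b' := lin_reify K b l in
      constr:(@LAdd K a' b')
  | (- ?a)%R => let a' := lin_reify K a l in constr:(@LOpp K a')
  | (?c *: ?a)%R => let a' := lin_reify K a l in constr:(@LScale K c a')
  | 0%R => constr:(@LZero K)
  | _ => let i := lin_index t l in constr:(@LVar K i)
  end.
(** Proves an equality of two vectors by comparing the coefficients of every
    atom.  Products in an algebra count as atoms, so they have to be expanded
    beforehand. *)
Ltac lin_over K :=
  match goal with
  | |- @eq ?T ?a ?b =>
    let l := lin_atoms a (@nil T) in let l := lin_atoms b l in
    let e1 := lin_reify K a l in let e2 := lin_reify K b l in
    refine (@leval_eq K _ l e1 e2 _);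
    cbv [lcoef_eq lcoef eqn size];
    repeat (apply: conj; [try by [] | try exact I]);
    try (field; by [])
  end.
Ltac lin := match goal with R : realType |- _ => lin_over constr:(R[i]) end.

(** * A scalar iteration that controls convergence *)

Section sqrt_iteration.
Variable R : realType.
Local Notation C := R[i].

(** The iterates of q -> (y + q ^ 2) / 2 from 0, for y = 1.  For an operator y
    of norm at most 1 the differences of successive iterates are bounded by
    those of tau, because this map has nonnegative coefficients. *)
Fixpoint tau (n : nat) : C :=
  if n is n'.+1 then (1 + tau n' ^+ 2) / 2 else 0.

Lemma tau_ge0 n : 0 <= tau n.
Proof.
by elim: n => //= n IH; rewrite divr_ge0 ?addr_ge0 ?exprn_ge0.
Qed.

Lemma tau_real n : tau n \is Num.real.
Proof. by rewrite ger0_real ?tau_ge0. Qed.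

(** In terms of d = 1 - tau n the iteration is d -> d - d ^ 2 / 2, an increasing
    map on [0, 1] that sends 2 / (n + 2) below 2 / (n + 3). *)
Lemma tau_le n : 1 - tau n <= 2 / n.+2%:R.
Proof.
have posn m : 0 < m.+1%:R :> C by [].
suff: (0 <= 1 - tau n <= 2 / n.+2%:R) by case/andP.
elim: n => [|n /andP[IH0 IH1]] /=.
  by rewrite subr0 ler01 divff ?lexx ?pnatr_eq0.
set d := 1 - tau n in IH0 IH1.
have -> : 1 - (1 + tau n ^+ 2) / 2 = d - d ^+ 2 / 2 by rewrite /d; field.
set x := 2 / n.+2%:R in IH1.
have x1 : x <= 1 by rewrite ler_pdivrMr // mul1r ler_nat.
apply/andP; split.
  have -> : d - d ^+ 2 / 2 = d * (1 - d) + d ^+ 2 / 2 by field.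
  rewrite addr_ge0 ?divr_ge0 ?exprn_ge0 // mulr_ge0 // subr_ge0.
  exact: le_trans IH1 x1.
apply: (@le_trans _ _ (x - x ^+ 2 / 2)).
  rewrite -subr_ge0.
  have -> : x - x ^+ 2 / 2 - (d - d ^+ 2 / 2)
    = (x - d) * ((1 - x) + (1 - d)) / 2 by field.
  rewrite divr_ge0 // mulr_ge0 ?subr_ge0 // addr_ge0 ?subr_ge0 //.
  exact: le_trans IH1 x1.
rewrite -subr_ge0 /x -(natr1 n.+2).
have := posn n.+1; move: (n.+2%:R : C) => m m0.
have -> : 2 / (m + 1) - (2 / m - (2 / m) ^+ 2 / 2) = 2 / ((m + 1) * m ^+ 2).
  by field; rewrite !lt0r_neq0 // addr_gt0.
by rewrite divr_ge0 // mulr_ge0 ?exprn_ge0 ?addr_ge0 // ltW.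
Qed.

Lemma tau_le1 n : tau n <= 1.
Proof.
elim: n => [|n IH] /=; first exact: ler01.
by rewrite ler_pdivrMr // mul1r lerD // exprn_ile1 ?tau_ge0.
Qed.

Lemma tau_incr n : 0 <= tau n.+1 - tau n.
Proof.
have -> : tau n.+1 - tau n = (1 - tau n) ^+ 2 / 2 by rewrite /=; field.
by rewrite divr_ge0 // exprn_ge0 // subr_ge0 tau_le1.
Qed.

End sqrt_iteration.

Section limits.
Variable R : realType.
Local Notation K := R[i].
Implicit Types (V W U : normedModType K).

Lemma tau_rate (M e : K) : 0 <= M -> 0 < e -> exists n, M * (2 / n.+2%:R) < e.
Proof.
move=> M0 e0.
have eR : (complex.Re e)%:C%C = e by rewrite RRe_real // gtr0_real.
have MR : (complex.Re M)%:C%C = M by rewrite RRe_real // ger0_real.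
have er0 : 0 < complex.Re e by rewrite -ltcR eR.
have mr0 : 0 <= complex.Re M by rewrite -lecR MR.
have x0 : 0 <= complex.Re M * 2 / complex.Re e.
  by rewrite divr_ge0 ?mulr_ge0 // ltW.
have := Num.Theory.archi_boundP x0; set n := Num.Def.archi_bound _ => ltn.
exists n.
have n20 : 0 < n.+2%:R :> K by [].
rewrite mulrA ltr_pdivrMr // -ltr_pdivrMl // mulrC.
rewrite -MR -eR (_ : 2 = 2%:R%:C%C); last by rewrite rmorph_nat.
rewrite -fmorphV -!rmorphM /= -(rmorph_nat (real_complex R)) ltcR.
by apply: (lt_trans ltn); rewrite ltr_nat.
Qed.

Lemma tau_cvg :
  (tau R : nat -> (K : numFieldType)) @ \oo --> (1 : (K : numFieldType)).
Proof.
apply/cvgrPdist_le => e e0; have [n ltn] := tau_rate ler01 e0.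
exists n => // m /= le_nm; rewrite ger0_norm ?subr_ge0 ?tau_le1 //.
apply: le_trans (ltW ltn); rewrite mul1r; apply: le_trans (tau_le _ m) _.
by rewrite ler_wpM2l // lef_pV2 ?posrE // ler_nat.
Qed.

Lemma cvg_by_tau (V : completeNormedModType K) (a : nat -> V) (M : K) :
  0 <= M -> (forall n, `|a n.+1 - a n| <= M * (tau R n.+1 - tau R n)) ->
  exists l : V, a @ \oo --> l.
Proof.
move=> M0 aM.
have le_diff n k : `|a (n + k)%N - a n| <= M * (tau R (n + k) - tau R n).
  elim: k => [|k IH]; first by rewrite addn0 !subrr normr0 mulr0.
  rewrite addnS -(subrKA (a (n + k)%N)) -(subrKA (tau R (n + k))) mulrDr.
  exact: le_trans (ler_normD _ _) (lerD (aM _) IH).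
suff: cvg (a @ \oo) by move=> /cvg_ex.
apply/cauchy_cvgP; apply: cauchy_exP => e e0.
have [n ltn] := tau_rate M0 e0.
exists (a n); exists n => // m /= /subnKC <-.
rewrite -ball_normE /= distrC; apply: le_lt_trans ltn.
apply: le_trans (le_diff _ _) _; rewrite ler_wpM2l //.
by apply: le_trans (tau_le _ n); rewrite lerD2r tau_le1.
Qed.

(** Stated for additive maps so as to cover conjugate-linear ones. *)
Lemma cvg_additive V W (f : V -> W) (M : K) (a : nat -> V) (l : V) :
  (forall x y, f (x - y) = f x - f y) -> 0 <= M ->
  (forall x, `|f x| <= M * `|x|) ->
  a @ \oo --> l -> f (a n) @[n --> \oo] --> f l.
Proof.
move=> fB M0 fM al; apply/cvgrPdist_le => e e0.
have M1 : 0 < M + 1 by rewrite ltr_wpDl.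
have e1 : 0 < e / (M + 1) by rewrite divr_gt0.
move/cvgrPdist_le/(_ _ e1): al; apply: filterS => n le_n.
rewrite -fB; apply: le_trans (fM _) _.
apply: le_trans (_ : (M + 1) * (e / (M + 1)) <= _).
  by rewrite ler_pM // lerDl.
by rewrite mulrC divfK // gt_eqF.
Qed.

Lemma cvg_biadditive V W U (f : V -> W -> U) (M : K) (a : nat -> V) (l : V)
    (b : nat -> W) (m : W) :
  (forall x y z, f (x - y) z = f x z - f y z) ->
  (forall x y z, f x (y - z) = f x y - f x z) ->
  0 <= M -> (forall x y, `|f x y| <= M * `|x| * `|y|) ->
  a @ \oo --> l -> b @ \oo --> m -> f (a n) (b n) @[n --> \oo] --> f l m.
Proof.
move=> fBl fBr M0 fM al bm.
have lim_m : f (a n) m @[n --> \oo] --> f l m.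
  apply: (@cvg_additive _ _ (f ^~ m) (M * `|m|)) => //; first exact: mulr_ge0.
  by move=> x; rewrite mulrAC.
have lim_l : f l (b n) @[n --> \oo] --> f l m.
  by apply: (@cvg_additive _ _ (f l) (M * `|l|)) => //; exact: mulr_ge0.
have lim0 : f (a n - l) (b n - m) @[n --> \oo] --> (0 : U).
  apply/cvgrPdist_le => e e0.
  have M1 : 0 < M + 1 by rewrite ltr_wpDl.
  have e1 : 0 < e / (M + 1) by rewrite divr_gt0.
  move/cvgrPdist_le/(_ _ ltr01): al => al1.
  move/cvgrPdist_le/(_ _ e1): bm => bm1.
  apply: filterS2 al1 bm1 => n le_a le_b; rewrite sub0r normrN.
  apply: le_trans (fM _ _) _; rewrite distrC [`|b n - m|]distrC.
  apply: le_trans (_ : (M + 1) * (e / (M + 1)) <= _).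
    rewrite ler_pM ?mulr_ge0 // (le_trans _ (_ : M <= _)) ?lerDl //.
    by rewrite ler_piMr.
  by rewrite mulrC divfK // gt_eqF.
rewrite (_ : (fun n => _) = (fun n =>
    f (a n - l) (b n - m) + f (a n) m + (f l (b n) - f l m))); last first.
  by apply/funext => n; rewrite fBl !fBr; lin.
have E : 0 + f l m + (f l m - f l m) = f l m by lin.
rewrite -[X in _ --> X]E.
by apply: cvgD; [apply: cvgD|apply: cvgB => //; exact: cvg_cst].
Qed.

Lemma cvg_le_norm V (a : nat -> V) (l : V) (M : K) :
  (forall n, `|a n| <= M) -> a @ \oo --> l -> `|l| <= M.
Proof.
move=> aM /cvgrPdist_le al; apply/ler_addgt0Pr => e e0.
have [n /= le_n] := filter_ex (al _ e0).
by rewrite -(subrK (a n) l) addrC; apply: le_trans (ler_normD _ _) (lerD _ _).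
Qed.

Lemma cvg_uniq V (a b : nat -> V) (l m : V) :
  (forall n, a n = b n) -> a @ \oo --> l -> b @ \oo --> m -> l = m.
Proof.
move=> /funext -> bl bm; exact: (cvg_unique (@norm_hausdorff _ V) bl bm).
Qed.

Lemma cvg_shift V (a : nat -> V) (l : V) :
  a @ \oo --> l -> a n.+1 @[n --> \oo] --> l.
Proof.
move=> /cvgrPdist_le al; apply/cvgrPdist_le => e /al [N _ NP].
by exists N => // n /= le_n; apply: NP; rewrite /= leqW.
Qed.

End limits.

(** * Square roots in C*-algebras *)

Section cstar_theory.
Variables (R : realType) (A : cstarAlgType R).
Local Notation K := R[i].
Implicit Types a b h k s x : A.

Lemma cmulZl (c : K) a b : (c *: a) ** b = c *: (a ** b).
Proof. by rewrite cscaleAl. Qed.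
Lemma cmulZr (c : K) a b : a ** (c *: b) = c *: (a ** b).
Proof. by rewrite cscaleAr. Qed.
Lemma cmul0l a : 0 ** a = 0 :> A.
Proof. by rewrite -(scale0r (0 : A)) cmulZl !scale0r. Qed.
Lemma cmul0r a : a ** 0 = 0 :> A.
Proof. by rewrite -(scale0r (0 : A)) cmulZr !scale0r. Qed.
Lemma cmulNl a b : (- a) ** b = - (a ** b).
Proof. by rewrite -scaleN1r cmulZl scaleN1r. Qed.
Lemma cmulNr a b : a ** (- b) = - (a ** b).
Proof. by rewrite -scaleN1r cmulZr scaleN1r. Qed.
Definition cmulE := (@cmulDl R A, @cmulDr R A, cmulNl, cmulNr, cmulZl, cmulZr,
  cmul0l, cmul0r, @cmulA R A).

Lemma star0 : star 0 = 0 :> A.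
Proof. by rewrite -(scale0r (0 : A)) starZ rmorph0 !scale0r. Qed.
Lemma starN a : star (- a) = - star a.
Proof. by rewrite -scaleN1r starZ rmorphN1 scaleN1r. Qed.
Lemma starB a b : star (a - b) = star a - star b.
Proof. by rewrite starD starN. Qed.
Lemma starZr (c : K) a : c \is Num.real -> star (c *: a) = c *: star a.
Proof. by move=> cR; rewrite starZ conj_Creal. Qed.
Definition starE := (@starD R A, starN, @starM R A, star0, @starK R A).

Lemma cvg_cmul (a b : nat -> A) (l m : A) :
  a @ \oo --> l -> b @ \oo --> m -> a n ** b n @[n --> \oo] --> l ** m.
Proof.
apply: (@cvg_biadditive _ _ _ _ (@cmul R A) 1) => // [x y z|x y z|x y].
- by rewrite cmulDl cmulNl.
- by rewrite cmulDr cmulNr.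
- by rewrite mul1r cnormM.
Qed.

Lemma cvg_star (a : nat -> A) (l : A) :
  a @ \oo --> l -> star (a n) @[n --> \oo] --> star l.
Proof.
apply: (@cvg_additive _ _ _ (@star R A) 1) => // [x y|x]; first exact: starB.
by rewrite mul1r norm_star.
Qed.

Lemma star_mul_eq0 a : star a ** a = 0 -> a = 0.
Proof.
move=> a0; apply/eqP; rewrite -normr_eq0 -sqrf_eq0 -cnorm_star.
by rewrite a0 normr0.
Qed.

Lemma sqr_eq0 a : star a = a -> a ** a = 0 -> a = 0.
Proof. by move=> sa; rewrite -{1}sa; exact: star_mul_eq0. Qed.

(** In a C*-algebra the norm is the operator norm of left multiplication. *)
Lemma norm_le_mul (M : K) a :
  0 <= M -> (forall x, `|a ** x| <= M * `|x|) -> `|a| <= M.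
Proof.
move=> M0 aM; have [->|a0] := eqVneq a 0; first by rewrite normr0.
rewrite -(@ler_pM2r _ `|a|) ?normr_gt0 // -expr2 -norm_star -cnorm_star starK.
exact: aM.
Qed.

Lemma self_adjoint_parts a : exists u v,
  [/\ star u = u, star v = v, a = u + 'i *: v, `|u| <= `|a| & `|v| <= `|a|].
Proof.
have half0 : 0 <= 2^-1 :> K by rewrite invr_ge0.
have half : (2^-1 : K) \is Num.real by rewrite ger0_real.
exists (2^-1 *: (a + star a)), (2^-1 *: ('i *: (star a - a))).
have i2 : 'i * 'i = -1 :> K by rewrite -expr2 sqrCi.
have norm2 : `|a| + `|star a| = 2 * `|a| by rewrite norm_star; ring.
split.
- by rewrite starZr // !starE addrC.
- by rewrite starZr // starZ conjCi starB starK; lin.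
- by rewrite !scalerA mulrAC i2; lin.
- rewrite normrZ ger0_norm // ler_pdivrMl //.
  by apply: le_trans (ler_normD _ _) _; rewrite norm2.
- rewrite !normrZ normCi mul1r ger0_norm // ler_pdivrMl //.
  by apply: le_trans (ler_normB _ _) _; rewrite addrC norm2.
Qed.

(** The bound |t - h| <= t, read through left multiplication since A need not
    have a unit. *)
Definition contractive_shift (t : K) h :=
  forall x, `|t *: x - h ** x| <= t * `|x|.

(** With y = 1 - h, the iterates q of q -> (y + q ^ 2) / 2 tend to 1 - sqrt h.
    They are not in A, but tau n - q n is, and this is sqrt_seq h n. *)
Fixpoint sqrt_seq h (n : nat) : A :=
  if n is n'.+1 then
    2^-1 *: (h + (2 * tau R n') *: sqrt_seq h n'
             - sqrt_seq h n' ** sqrt_seq h n')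
  else 0.

Section sqrt.
Variable h : A.
Hypotheses (sh : star h = h) (h1 : contractive_shift 1 h).
Local Notation a := (sqrt_seq h).
Local Notation t := (tau R).

Let half_real : (2^-1 : K) \is Num.real.
Proof. by rewrite ger0_real // invr_ge0. Qed.

Let norm_half x : `|(2^-1 : K) *: x| = 2^-1 * `|x|.
Proof. by rewrite normrZ ger0_norm // invr_ge0. Qed.

Let a_comm k n : k ** h = h ** k -> k ** a n = a n ** k.
Proof.
move=> kh; elim: n => [|n IH] /=; first by rewrite !cmulE.
have ka2 : k ** a n ** a n = a n ** a n ** k by rewrite IH -cmulA IH cmulA.
by rewrite !cmulE kh ka2 IH.
Qed.

Let a_star n : star (a n) = a n.
Proof.
elim: n => [|n IH] /=; first exact: star0.
by rewrite starZr // !starE sh starZr ?IH // rpredM ?tau_real // realn.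
Qed.

Let a_contr n : contractive_shift (t n) (a n).
Proof.
elim: n => [|n IH] x; first by rewrite /= scale0r cmul0l subrr normr0 mul0r.
have -> : t n.+1 *: x - a n.+1 ** x = 2^-1 *: ((1 *: x - h ** x) +
   (t n *: (t n *: x - a n ** x) - a n ** (t n *: x - a n ** x))).
  by rewrite /= !cmulE; lin.
rewrite norm_half [t n.+1]mulrC -mulrA ler_wpM2l ?invr_ge0 //.
rewrite mulrDl; apply: le_trans (ler_normD _ _) (lerD (h1 x) _).
apply: le_trans (IH _) _; rewrite expr2 -mulrA ler_wpM2l ?tau_ge0 //.
Qed.

Let a_diff n x :
  `|(t n.+1 - t n) *: x - (a n.+1 - a n) ** x| <= (t n.+1 - t n) * `|x|.
Proof.
elim: n x => [|n IH] x.
  have -> : (t 1 - t 0) *: x - (a 1 - a 0) ** x = 2^-1 *: (1 *: x - h ** x).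
    by rewrite /= !cmulE; lin.
  rewrite norm_half (_ : t 1 - t 0 = 2^-1 * 1) -?mulrA; last first.
    by rewrite /=; field.
  by rewrite ler_wpM2l ?invr_ge0.
(* For successive iterates q and q', the next difference is half of
   q' ^ 2 - q ^ 2 = q' (q' - q) + (q' - q) q. *)
set d := t n.+1 - t n in IH; pose D y := d *: y - (a n.+1 - a n) ** y.
have -> : (t n.+2 - t n.+1) *: x - (a n.+2 - a n.+1) ** x = 2^-1 *:
  ((t n.+1 *: D x - a n.+1 ** D x) + D (t n *: x - a n ** x)).
  have tE : t n.+2 - t n.+1 = 2^-1 * (d * (t n.+1 + t n)).
    by rewrite /d (_ : t n.+2 = (1 + t n.+1 ^+ 2) / 2) //= ; field.
  have aE : a n.+2 - a n.+1 = 2^-1 *: ((2 * t n.+1) *: a n.+1 - a n.+1 ** a n.+1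
     - ((2 * t n) *: a n - a n ** a n)).
    rewrite (_ : a n.+2 =
      2^-1 *: (h + (2 * t n.+1) *: a n.+1 - a n.+1 ** a n.+1)) //.
    rewrite {4}(_ : a n.+1 = 2^-1 *: (h + (2 * t n) *: a n - a n ** a n)) //.
    by lin.
  rewrite tE aE /D /d; move: (a n.+1) (a n) (t n.+1) (t n) => u v p q.
  by rewrite !cmulE; lin.
have tE : t n.+2 - t n.+1 = 2^-1 * (t n.+1 * d + d * t n).
  by rewrite /d (_ : t n.+2 = (1 + t n.+1 ^+ 2) / 2) //= ; field.
rewrite norm_half tE -mulrA ler_wpM2l ?invr_ge0 // mulrDl.
apply: le_trans (ler_normD _ _) (lerD _ _).
  apply: le_trans (a_contr _ _) _; rewrite -mulrA ler_wpM2l ?tau_ge0 //.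
  exact: IH.
apply: le_trans (IH _) _; rewrite -mulrA ler_wpM2l ?tau_incr //.
exact: a_contr.
Qed.

Let a_cvg : exists s : A, a @ \oo --> s.
Proof.
apply: (@cvg_by_tau _ _ _ 2) => // n.
apply: norm_le_mul => [|x]; first by rewrite mulr_ge0 ?tau_incr.
have -> : (a n.+1 - a n) ** x = (t n.+1 - t n) *: x -
  ((t n.+1 - t n) *: x - (a n.+1 - a n) ** x) by lin.
apply: le_trans (ler_normB _ _) _.
rewrite -mulrA mulrDl mul1r lerD ?a_diff //.
by rewrite normrZ ger0_norm ?tau_incr.
Qed.

Lemma sqrt_of_contractive : exists s, [/\ star s = s, s ** s = h,
  contractive_shift 1 s & forall k, k ** h = h ** k -> k ** s = s ** k].
Proof.
have [s as_] := a_cvg; exists s; split.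
- by apply: (cvg_uniq _ (cvg_star as_) as_) => n; exact: a_star.
- have s2 : s = 2^-1 *: (h + (2 * 1) *: s - s ** s).
    apply: (cvg_uniq (fun=> erefl) (cvg_shift as_)).
    apply: cvgZ; first exact: cvg_cst.
    apply: cvgB; last exact: cvg_cmul.
    apply: cvgD; first exact: cvg_cst.
    by apply: cvgZ => //; apply: cvgM; [exact: cvg_cst|exact: tau_cvg].
  have -> : s ** s = h + 2 *: s - 2 *: (2^-1 *: (h + (2 * 1) *: s - s ** s)).
    by lin.
  by rewrite -s2; lin.
- move=> x; apply: (@cvg_le_norm _ _ (fun n => t n *: x - a n ** x)).
    move=> n; apply: le_trans (a_contr _ _) _.
    by rewrite ler_wpM2r // tau_le1.
  apply: cvgB; first by apply: cvgZ; [exact: tau_cvg|exact: cvg_cst].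
  by apply: cvg_cmul => //; exact: cvg_cst.
- move=> k kh; apply: (cvg_uniq (fun n => a_comm n kh)); apply: cvg_cmul => //;
  exact: cvg_cst.
Qed.

End sqrt.
End cstar_theory.

(** * Representations contract selfadjoint elements *)

(** The product m plays the role of a C*-algebra product; besides the product of
    A it will be c <x, x> d for a vector x of a Hilbert module. *)
Section weighted_product.
Variables (R : realType) (A : cstarAlgType R).
Local Notation K := R[i].
Variables (m : A -> A -> A) (kappa : K).
Hypotheses (kappa0 : 0 < kappa)
  (mP : forall (c : K) x y z, m (c *: x + y) z = c *: m x z + m y z)
  (mA : forall x y z, m x (m y z) = m (m x y) z)
  (m_star : forall x y, star (m x y) = m (star y) (star x))
  (m_norm : forall x y, `|m x y| <= kappa * `|x| * `|y|).

Let mPr (c : K) x y z : m x (c *: y + z) = c *: m x y + m x z.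
Proof.
rewrite -[LHS]starK m_star starD starZ mP starD starZ !m_star !starK.
by rewrite conjCK.
Qed.

Let mDl x y z : m (x + y) z = m x z + m y z.
Proof. by have := mP 1 x y z; rewrite !scale1r. Qed.
Let m0l z : m 0 z = 0.
Proof. by have := mP (-1) 0 0 z; rewrite scaler0 addr0 scaleN1r addNr. Qed.
Let mZl c x z : m (c *: x) z = c *: m x z.
Proof. by have := mP c x 0 z; rewrite m0l !addr0. Qed.
Let mDr x y z : m x (y + z) = m x y + m x z.
Proof. by have := mPr 1 x y z; rewrite !scale1r. Qed.
Let m0r z : m z 0 = 0.
Proof. by have := mPr (-1) z 0 0; rewrite scaler0 addr0 scaleN1r addNr. Qed.
Let mZr c x z : m x (c *: z) = c *: m x z.
Proof. by have := mPr c x z 0; rewrite m0r !addr0. Qed.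
Let mBl x y z : m (x - y) z = m x z - m y z.
Proof. by rewrite mDl -scaleN1r mZl scaleN1r. Qed.
Let mBr x y z : m x (y - z) = m x y - m x z.
Proof. by rewrite mDr -scaleN1r mZr scaleN1r. Qed.

Let cvg_m (a b : nat -> A) (k l : A) :
  a @ \oo --> k -> b @ \oo --> l -> m (a n) (b n) @[n --> \oo] --> m k l.
Proof. by apply: cvg_biadditive m_norm; [exact: mBl|exact: mBr|exact: ltW]. Qed.

Fixpoint quadratic_seq h (n : nat) : A :=
  if n is n'.+1 then 2^-1 *: (h + m (quadratic_seq h n') (quadratic_seq h n'))
  else 0.

Section quadratic.
Variable h : A.
Hypotheses (sh : star h = h) (h1 : kappa * `|h| <= 1).
Local Notation b := (quadratic_seq h).
Local Notation t := (tau R).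

Let norm_half (x : A) : `|(2^-1 : K) *: x| = 2^-1 * `|x|.
Proof. by rewrite normrZ ger0_norm // invr_ge0. Qed.

Let kM x y s u : kappa * `|x| <= s -> kappa * `|y| <= u ->
  kappa * `|m x y| <= s * u.
Proof.
have k0 := ltW kappa0.
move=> xs yu; apply: le_trans _ (ler_pM _ _ xs yu); rewrite ?mulr_ge0 //.
rewrite (_ : _ * _ * (_ * _) = kappa * (kappa * `|x| * `|y|)); last by ring.
by rewrite ler_wpM2l.
Qed.

Let b_norm n : kappa * `|b n| <= t n.
Proof.
elim: n => [|n IH] /=; first by rewrite normr0 mulr0.
rewrite norm_half mulrCA [leRHS]mulrC ler_wpM2l ?invr_ge0 //.
apply: le_trans (ler_wpM2l (ltW kappa0) (ler_normD _ _)) _.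
by rewrite mulrDr lerD // expr2 kM.
Qed.

Let b_diff n : kappa * `|b n.+1 - b n| <= t n.+1 - t n.
Proof.
elim: n => [|n IH].
  rewrite /= subr0 m0l addr0 norm_half subr0 mulrCA expr0n addr0 mulrC.
  by rewrite ler_wpM2r ?invr_ge0.
have -> : b n.+2 - b n.+1 =
    2^-1 *: (m (b n.+1) (b n.+1 - b n) + m (b n.+1 - b n) (b n)).
  rewrite mBl mBr [LHS](_ : _ = 2^-1 *: (h + m (b n.+1) (b n.+1))
    - 2^-1 *: (h + m (b n) (b n))) //.
  by move: (b n.+1) (b n) => u v; lin.
have tE : t n.+2 - t n.+1 =
    2^-1 * (t n.+1 * (t n.+1 - t n) + (t n.+1 - t n) * t n).
  by rewrite (_ : t n.+2 = (1 + t n.+1 ^+ 2) / 2) //= ; field.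
rewrite tE norm_half mulrCA ler_wpM2l ?invr_ge0 //.
apply: le_trans (ler_wpM2l (ltW kappa0) (ler_normD _ _)) _.
by rewrite mulrDr lerD // kM.
Qed.

(** In a unitization for the product m the conclusion reads
    (1 - b) ^ 2 = 1 - h. *)
Lemma quadratic_solution : exists b, [/\ 2 *: b = h + m b b, star b = b &
  forall k, m k h = m h k -> m k b = m b k].
Proof.
have [s bs] : exists s : A, b @ \oo --> s.
  apply: (@cvg_by_tau _ _ _ kappa^-1) => [|n]; first by rewrite invr_ge0 ltW.
  by rewrite ler_pdivlMl.
exists s; split.
- have {1}-> : s = 2^-1 *: (h + m s s).
    apply: (cvg_uniq (fun=> erefl) (cvg_shift bs)).
    apply: cvgZ; first exact: cvg_cst.
    by apply: cvgD; [exact: cvg_cst|exact: cvg_m].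
  by lin.
- apply: (cvg_uniq _ (cvg_star bs) bs); elim=> [|n IH] /=; first exact: star0.
  by rewrite starZr ?starD ?sh ?m_star ?IH // ger0_real // invr_ge0.
- move=> k kh.
  have kb n : m k (b n) = m (b n) k.
    elim: n => [|n IH] /=; first by rewrite m0l m0r.
    by rewrite mZr mZl mDr mDl kh mA IH -mA IH mA.
  by apply: (cvg_uniq kb); apply: cvg_m => //; exact: cvg_cst.
Qed.

End quadratic.
End weighted_product.

Section hilbert_module_theory.
Variables (R : realType) (C : cstarAlgType R) (Y : hilbertModType C).
Local Notation K := R[i].
Implicit Types (x y z : Y) (a c : C).

Lemma innerDr x y z : inner x (y + z) = inner x y + inner x z :> C.
Proof. by have := @innerPr R C Y 1 x y z; rewrite !scale1r. Qed.
Lemma inner0r x : inner x 0 = 0 :> C.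
Proof.
by have := @innerPr R C Y (-1) x 0 0; rewrite scaler0 addr0 scaleN1r addNr.
Qed.
Lemma innerZr (k : K) x y : inner x (k *: y) = k *: inner x y :> C.
Proof. by have := @innerPr R C Y k x y 0; rewrite inner0r !addr0. Qed.
Lemma innerNr x y : inner x (- y) = - inner x y :> C.
Proof. by rewrite -scaleN1r innerZr scaleN1r. Qed.
Lemma innerDl x y z : inner (x + y) z = inner x z + inner y z :> C.
Proof. by rewrite -inner_star innerDr starD !inner_star. Qed.
Lemma inner0l x : inner 0 x = 0 :> C.
Proof. by rewrite -inner_star inner0r star0. Qed.
Lemma innerZl (k : K) x y : inner (k *: x) y = k^* *: inner x y :> C.
Proof. by rewrite -inner_star innerZr starZ inner_star. Qed.
Lemma innerNl x y : inner (- x) y = - inner x y :> C.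
Proof. by rewrite -inner_star innerNr starN inner_star. Qed.
Lemma inner_ractl x y c : inner (ract x c) y = star c ** inner x y :> C.
Proof. by rewrite -inner_star inner_ract starM inner_star. Qed.
Definition innerE := (innerDr, innerDl, innerZr, innerZl, innerNr, innerNl,
  inner0r, inner0l, @inner_ract R C Y, inner_ractl).

Lemma inner_eq0 x : inner x x = 0 :> C -> x = 0.
Proof.
move=> x0; apply/eqP; rewrite -normr_eq0 -sqrf_eq0.
by rewrite (@norm_inner R C Y) x0 normr0.
Qed.

Lemma inner_ext x y : (forall z, inner z x = inner z y :> C) -> x = y.
Proof.
move=> xy; apply/eqP; rewrite -subr_eq0; apply/eqP/inner_eq0.
by rewrite innerDr innerNr xy subrr.
Qed.

(** T + i Z and T - i Z preserve the inner product, and T and Z are half the sum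
    and the difference of these isometries, up to a unit scalar. *)
Lemma adjoint_sum_squares (T Z : Y -> Y) :
  is_adjoint T T -> is_adjoint Z Z -> (forall x, T (Z x) = Z (T x)) ->
  (forall x, T (T x) + Z (Z x) = x) ->
  forall x, `|T x| <= `|x| /\ `|Z x| <= `|x|.
Proof.
move=> aT aZ TZ sq x.
have isom (u : K) : u^* = - u -> u ^+ 2 = -1 -> `|T x + u *: Z x| = `|x|.
  move=> cu u2; apply: (@pexpIrn _ 2); rewrite ?nnegrE // !(@norm_inner R C Y).
  congr `|_|; have -> : inner x x = inner x (T (T x)) + inner x (Z (Z x)) :> C.
    by rewrite -innerDr sq.
  rewrite !innerE cu !aT !aZ TZ ?scalerDr scalerA ?mulNr ?mulrN -expr2 u2; lin.
have i2 : 'i ^+ 2 = -1 :> K by rewrite sqrCi.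
have Ui := isom 'i (conjCi _) i2.
have Uj : `|T x + (- 'i) *: Z x| = `|x|.
  by apply: isom; rewrite ?rmorphN /= ?conjCi // sqrrN.
have half : 0 <= 2^-1 :> K by rewrite invr_ge0.
split.
  have -> : T x = 2^-1 *: ((T x + 'i *: Z x) + (T x + (- 'i) *: Z x)) by lin.
  rewrite normrZ ger0_norm // ler_pdivrMl //.
  by apply: le_trans (ler_normD _ _) _; rewrite Ui Uj -mulr2n mulr_natl.
rewrite -[`|Z x|]mul1r -(normCi K) -normrZ.
have -> : 'i *: Z x =
    2^-1 *: ((T x + 'i *: Z x) - (T x + (- 'i) *: Z x)) by lin.
rewrite normrZ ger0_norm // ler_pdivrMl //.
by apply: le_trans (ler_normB _ _) _; rewrite Ui Uj -mulr2n mulr_natl.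
Qed.

End hilbert_module_theory.

Section contractive_representation.
Variables (R : realType) (A B : cstarAlgType R) (Y : hilbertModType B).
Local Notation K := R[i].
Variables (m : A -> A -> A) (kappa : K) (psi : A -> Y -> Y).
Hypotheses (kappa0 : 0 < kappa)
  (mP : forall (c : K) x y z, m (c *: x + y) z = c *: m x z + m y z)
  (mA : forall x y z, m x (m y z) = m (m x y) z)
  (m_star : forall x y, star (m x y) = m (star y) (star x))
  (m_norm : forall x y, `|m x y| <= kappa * `|x| * `|y|)
  (psiP : forall (c : K) a b y, psi (c *: a + b) y = c *: psi a y + psi b y)
  (psiM : forall a b y, psi (m a b) y = psi a (psi b y))
  (psi_adj : forall a, is_adjoint (psi a) (psi (star a))).

Let psiDr a x y : psi a (x + y) = psi a x + psi a y.
Proof.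
apply: inner_ext => z; rewrite innerDr -(starK a) -!psi_adj.
by rewrite innerDr.
Qed.
Let psiNr a x : psi a (- x) = - psi a x.
Proof.
by apply: inner_ext => z; rewrite innerNr -(starK a) -!psi_adj innerNr.
Qed.

(** Take b with (1 - b) ^ 2 = 1 - c ^ 2.  Applying psi writes the identity of Y
    as the sum of the squares of the commuting selfadjoint operators psi c and
    1 - psi b, which are therefore contractions; and so is the square of
    1 - psi b, that is 1 - psi (c ^ 2). *)
Lemma rep_contractive c x : star c = c -> kappa * `|c| <= 1 ->
  `|psi c x| <= `|x| /\ `|x - psi (m c c) x| <= `|x|.
Proof.
move=> sc c1.
have scc : star (m c c) = m c c by rewrite m_star sc.
have cc1 : kappa * `|m c c| <= 1.
  apply: le_trans (_ : (kappa * `|c|) * (kappa * `|c|) <= _).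
    rewrite (_ : _ * _ * (_ * _) = kappa * (kappa * `|c| * `|c|)); last by ring.
    by rewrite ler_wpM2l // ltW.
  by rewrite -expr2 exprn_ile1 // mulr_ge0 // ltW.
have [b [b2 sb bc]] :=
  quadratic_solution kappa0 mP mA m_star m_norm scc cc1.
have cb : m c b = m b c by apply: bc; rewrite mA.
pose Z y := y - psi b y.
have aZ : is_adjoint Z Z.
  by move=> y z; rewrite /Z !innerE psi_adj sb.
have aT : is_adjoint (psi c) (psi c) by rewrite -{2}sc; exact: psi_adj.
have TZ y : psi c (Z y) = Z (psi c y).
  by rewrite /Z psiDr psiNr -!psiM cb.
have ZZ y : Z (Z y) = y - psi (m c c) y.
  have := congr1 (psi ^~ y) b2; rewrite -(addr0 (2 *: b)) psiP.
  have -> : m c c + m b b = 1 *: m c c + m b b by rewrite scale1r.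
  have psi0 : psi 0 y = 0.
    by have := psiP (-1) 0 0 y; rewrite scaler0 addr0 scaleN1r addNr.
  rewrite psiP psi0 /Z psiDr psiNr -psiM scale1r addr0 => E.
  have -> : psi (m c c) y = 2 *: psi b y - psi (m b b) y by rewrite E addrK.
  by lin.
have sq y : psi c (psi c y) + Z (Z y) = y by rewrite ZZ psiM addrC subrK.
have TZ1 := adjoint_sum_squares aT aZ TZ sq.
split; first by have [] := TZ1 x.
rewrite -ZZ; exact: le_trans (TZ1 (Z x)).2 (TZ1 x).2.
Qed.

Lemma rep_norm_le c x : star c = c -> `|psi c x| <= kappa * `|c| * `|x|.
Proof.
move=> sc; have psi0 y : psi 0 y = 0.
  by have := psiP (-1) 0 0 y; rewrite scaler0 addr0 scaleN1r addNr.
have psiZ (k : K) a y : psi (k *: a) y = k *: psi a y.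
  by have := psiP k a 0 y; rewrite psi0 !addr0.
have [->|c0] := eqVneq c 0; first by rewrite psi0 !normr0 mulr0 mul0r.
have k0 : 0 < kappa * `|c| by rewrite mulr_gt0 ?normr_gt0.
have [||le_x _] := @rep_contractive ((kappa * `|c|)^-1 *: c) x.
- by rewrite starZr ?sc // gtr0_real // invr_gt0.
- by rewrite normrZ gtr0_norm ?invr_gt0 // mulrCA mulVf ?lexx // gt_eqF.
by move: le_x; rewrite psiZ normrZ gtr0_norm ?invr_gt0 // ler_pdivrMl.
Qed.

End contractive_representation.

(** A C*-algebra is a right Hilbert module over itself. *)
Definition regular (R : realType) (A : cstarAlgType R) : Type := A.

Section regular_module.
Variables (R : realType) (A : cstarAlgType R).
HB.instance Definition _ := CompleteNormedModule.on (regular A).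

Let ip (x y : regular A) : A := star (x : A) ** (y : A).
Let act (x : regular A) (a : A) : regular A := (x : A) ** a.
Let actDl x y a : act (x + y) a = act x a + act y a.
Proof. exact: cmulDl. Qed.
Let actDr x a b : act x (a + b) = act x a + act x b.
Proof. exact: cmulDr. Qed.
Let actA x a b : act x (a ** b) = act (act x a) b.
Proof. exact: cmulA. Qed.
Let actZl (c : R[i]) x a : act (c *: x) a = c *: act x a.
Proof. exact: cmulZl. Qed.
Let actZr (c : R[i]) x a : act x (c *: a) = c *: act x a.
Proof. exact: cmulZr. Qed.
Let ipP (c : R[i]) x y z : ip x (c *: y + z) = c *: ip x y + ip x z.
Proof. by rewrite /ip cmulDr cmulZr. Qed.
Let ip_act x y a : ip x (act y a) = ip x y ** a.
Proof. exact: cmulA. Qed.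
Let ip_star x y : star (ip x y) = ip y x.
Proof. by rewrite /ip starM starK. Qed.
Let ip_ge0 x : cpositive (ip x x).
Proof. by exists x. Qed.
Let norm_ip (x : regular A) : `|x| ^+ 2 = `|ip x x|.
Proof. by rewrite /ip cnorm_star. Qed.

HB.instance Definition _ := CompleteNormedModule_isHilbertModule.Build R A
  (regular A) actDl actDr actA actZl actZr ipP ip_act ip_star ip_ge0 norm_ip.
End regular_module.

(** * Positive elements *)

Section positive_elements.
Variables (R : realType) (A : cstarAlgType R).
Local Notation K := R[i].
Implicit Types a b d h k s x : A.

(** For selfadjoint h this says that the spectrum of h is nonnegative.  This
    form is visibly stable under sums, and is what the construction of square
    roots asks for. *)
Definition positive h :=
  star h = h /\ exists2 t : K, 0 < t & contractive_shift t h.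

Lemma positive_sqr h : star h = h -> positive (h ** h).
Proof.
move=> sh; split; first by rewrite starM sh.
pose r : K := `|h| + 1; have r0 : 0 < r by rewrite ltr_wpDl.
have rr : r^-1 \is Num.real by rewrite gtr0_real // invr_gt0.
exists (r ^+ 2) => [|x]; first exact: exprn_gt0.
have [] := @rep_contractive R A A (regular A) (@cmul R A) 1 (@cmul R A)
   ltr01 _ _ _ _ _ _ _ (r^-1 *: h) x.
- by move=> c u v w; rewrite cmulDl cmulZl.
- exact: cmulA.
- exact: starM.
- by move=> u v; rewrite mul1r cnormM.
- by move=> c u v w; rewrite cmulDl cmulZl.
- by move=> u v w; exact/esym/cmulA.
- move=> u v w.
  change (star (u ** (v : A)) ** w = star (v : A) ** (star u ** w)).
  by rewrite starM cmulA.
- by rewrite starZr ?sh.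
- rewrite mul1r normrZ gtr0_norm ?invr_gt0 // mulrC ler_pdivrMr // mul1r.
  by rewrite ltW // ltr_pwDr.
move=> _ le_x.
have -> : r ^+ 2 *: x - h ** h ** x =
    r ^+ 2 *: (x - (r^-1 *: h) ** (r^-1 *: h) ** x).
  rewrite scalerBr !cmulE !scalerA; congr (_ - _).
  by rewrite -expr2 exprVn mulfV ?scale1r // gt_eqF // exprn_gt0.
by rewrite normrZ gtr0_norm ?exprn_gt0 // ler_pM2l ?exprn_gt0.
Qed.

Lemma positiveD h k : positive h -> positive k -> positive (h + k).
Proof.
move=> [sh [t t0 ht]] [sk [u u0 ku]]; split; first by rewrite starD sh sk.
exists (t + u) => [|x]; first exact: addr_gt0.
have -> : (t + u) *: x - (h + k) ** x = (t *: x - h ** x) + (u *: x - k ** x).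
  by rewrite cmulDl; lin.
by rewrite mulrDl; apply: le_trans (ler_normD _ _) (lerD _ _).
Qed.

Lemma positive_sqrt h : positive h -> exists s, [/\ star s = s, s ** s = h,
  positive s & forall k, k ** h = h ** k -> k ** s = s ** k].
Proof.
move=> [sh [t t0 ht]].
have st0 : 0 < sqrtC t by rewrite sqrtC_gt0.
have [||s [ss s2 s1 sc]] := @sqrt_of_contractive R A (t^-1 *: h).
- by rewrite starZr ?sh // gtr0_real // invr_gt0.
- move=> x; rewrite !mul1r.
  have -> : 1 *: x - (t^-1 *: h) ** x = t^-1 *: (t *: x - h ** x).
    by rewrite cmulZl scalerBr scalerA mulVf ?gt_eqF.
  by rewrite normrZ gtr0_norm ?invr_gt0 // ler_pdivrMl.
have sts : star (sqrtC t *: s) = sqrtC t *: s.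
  by rewrite starZr ?ss // gtr0_real.
exists (sqrtC t *: s); split=> //.
- rewrite cmulZl cmulZr scalerA -expr2 sqrtCK s2 scalerA mulfV ?scale1r //.
  by rewrite gt_eqF.
- split=> //; exists (sqrtC t) => // x.
  rewrite cmulZl -scalerBr normrZ gtr0_norm // ler_pM2l //.
  by have := s1 x; rewrite scale1r mul1r.
- move=> k kh; rewrite cmulZl cmulZr sc // cmulZl cmulZr.
  by rewrite kh.
Qed.

(** The element U = h + i k satisfies U^* U = h ^ 2 + k ^ 2. *)
Lemma sum_sqr_eq0 h k : star h = h -> star k = k -> h ** k = k ** h ->
  h ** h + k ** k = 0 -> h = 0.
Proof.
move=> sh sk hk hk0.
have i2 : 'i * 'i = -1 :> K by rewrite -expr2 sqrCi.
have U0 : h + 'i *: k = 0.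
  apply: star_mul_eq0; rewrite starD starZ conjCi sh sk !cmulE scalerA.
  by rewrite mulNr i2 hk -[RHS]hk0; lin.
have U'0 : h - 'i *: k = 0.
  have := congr1 (@star R A) U0.
  by rewrite starD starZ conjCi sh sk star0 scaleNr.
have -> : h = 2^-1 *: ((h + 'i *: k) + (h - 'i *: k)) by lin.
by rewrite U0 U'0 addr0 scaler0.
Qed.

Lemma positive_anti h : positive h -> positive (- h) -> h = 0.
Proof.
move=> ph /positive_sqrt[k [sk k2 _ kc]].
have [s [ss s2 _ sc]] := positive_sqrt ph.
have ks : s ** k = k ** s.
  by apply: kc; rewrite -s2 cmulNl cmulNr cmulA.
have s0 : s = 0 by apply: (sum_sqr_eq0 ss sk ks); rewrite s2 k2 subrr.
by rewrite -s2 s0 cmul0l.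
Qed.

(** The negative part m of a is (g - a) / 2, where g is the square root of
    a ^ 2.  As m ^ 2 = g m, the cube of m is the square of sqrt g m. *)
Lemma negative_part a : star a = a -> exists m n, [/\ star m = m,
  a ** m = - (m ** m) /\ m ** a = - (m ** m), (m = 0 -> positive a),
  (forall k, k ** a = a ** k -> k ** m = m ** k) &
  [/\ star n = n, n ** n = m ** m ** m & m ** n = n ** m]].
Proof.
move=> sa; have [g [sg g2 pg gc]] := positive_sqrt (positive_sqr sa).
have [r [sr r2 _ rc]] := positive_sqrt pg.
have ag : a ** g = g ** a by apply: gc; rewrite cmulA.
pose m : A := 2^-1 *: (g - a).
have half : (2^-1 : K) \is Num.real by rewrite ger0_real // invr_ge0.
have sm : star m = m by rewrite starZr // starB sg sa.
have am : a ** m = - (m ** m).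
  by rewrite /m !cmulE g2 ag; lin.
have mc k : k ** a = a ** k -> k ** m = m ** k.
  move=> ka; rewrite /m cmulZr cmulZl cmulDr cmulDl cmulNr cmulNl ka gc //.
  by rewrite cmulA ka -cmulA ka cmulA.
have ma : m ** a = a ** m by rewrite mc.
have mm : m ** m = g ** m by rewrite /m !cmulE g2 ag; lin.
have rm : r ** m = m ** r.
  rewrite -rc // /m cmulZl cmulZr cmulDl cmulDr cmulNl cmulNr ag //.
exists m, (r ** m); split=> //.
- by rewrite ma.
- have -> : a = g - 2 *: m by rewrite /m; lin.
  by move=> ->; rewrite scaler0 subr0.
- split.
  + by rewrite starM sm sr rm.
  + by rewrite !cmulA -[r ** m ** r]cmulA -rm !cmulA r2 -mm.
  + by rewrite cmulA -rm.
Qed.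

Lemma cube_mul_eq0 (m : A) : star m = m -> m ** (m ** m ** m) = 0 -> m = 0.
Proof.
move=> sm m4; apply: sqr_eq0 => //; apply: sqr_eq0; first by rewrite starM sm.
by rewrite -m4 !cmulA.
Qed.

(** With m the negative part of a, the element m a ^ 3 m equals both (q m) ^ 2
    and - m ^ 5.  Since m ^ 5 is the square of m n, all of these vanish. *)
Lemma positive_of_cube a q : star a = a -> star q = q -> q ** a = a ** q ->
  a ** a ** a = q ** q -> positive a.
Proof.
move=> sa sq qa a3.
have [m [n [sm [am ma] pos mc [sn n2 mn]]]] := negative_part sa.
have qm : q ** m = m ** q by exact: mc.
apply: pos; apply: cube_mul_eq0 => //.
have aam : a ** a ** m = m ** m ** m.
  by rewrite -cmulA am cmulNr cmulA am cmulNl opprK.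
have E : (q ** m) ** (q ** m) = - ((m ** n) ** (m ** n)).
  rewrite {1}qm !cmulA -[m ** q ** q]cmulA -a3 !cmulA ma !cmulNl.
  rewrite -[m ** m ** a ** a ** m]cmulA -!cmulA; congr (- _).
  rewrite [a ** (a ** m)]cmulA aam [n ** (m ** n)]cmulA -mn -!cmulA n2.
  by rewrite !cmulA.
have pE : positive ((m ** n) ** (m ** n)).
  by apply: positive_sqr; rewrite starM sm sn mn.
have mn0 : (m ** n) ** (m ** n) = 0.
  apply: positive_anti => //; rewrite -E; apply: positive_sqr.
  by rewrite starM sm sq qm.
have {}mn0 : m ** n = 0 by apply: sqr_eq0; rewrite ?starM ?sm ?sn ?mn // -mn.
by rewrite -n2 cmulA mn0 cmul0l.
Qed.

(** Let m be the negative part of d^* d and y = d m.  Then y^* y = - m ^ 3 is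
    the opposite of a square, while y^* y + y y^* is a sum of squares, so that
    y y^* is positive.  If s is its square root, the cube of y^* y is the square
    of y^* s y, so that y^* y is positive as well.  Hence y^* y and m vanish. *)
Lemma positive_star_mul d : positive (star d ** d).
Proof.
have sdd : star (star d ** d) = star d ** d by rewrite starM starK.
have [m [n [sm [am _] pos _ [sn n2 _]]]] := negative_part sdd.
pose y := d ** m.
have am' : star d ** (d ** m) = - (m ** m) by rewrite cmulA.
have yy : star y ** y = - (n ** n).
  by rewrite /y starM sm -cmulA am' cmulNr cmulA n2.
clearbody y.
have i2 : 'i * 'i = -1 :> K by rewrite -expr2 sqrCi.
have pyy : positive (y ** star y).
  have [u [v [su sv yE _ _]]] := self_adjoint_parts y.
  have -> : y ** star y = u ** u + u ** u + (v ** v + v ** v) + n ** n.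
    have -> : n ** n = - (star y ** y) by rewrite yy opprK.
    rewrite yE starD starZ conjCi su sv !cmulE !scalerA !mulrN !mulNr i2.
    by rewrite !opprK; lin.
  by do ![apply: positiveD | apply: positive_sqr].
have [s [ss s2 _ _]] := positive_sqrt pyy.
have yys x : x ** y ** star y = x ** s ** s by rewrite -cmulA -s2 cmulA.
have pa : positive (star y ** y).
  apply: (@positive_of_cube _ (star y ** s ** y)).
  - by rewrite starM starK.
  - by rewrite !starM starK ss cmulA.
  - by rewrite !cmulA !yys.
  - by rewrite !cmulA !yys.
have a0 : star y ** y = 0.
  by apply: positive_anti => //; rewrite yy opprK; exact: positive_sqr.
apply: pos; apply: cube_mul_eq0 => //.
by rewrite -n2 -[n ** n]opprK -yy a0 oppr0 cmul0r.
Qed.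

Lemma positive_cpositive a : positive a -> cpositive a.
Proof. by move=> /positive_sqrt[s [ss <- _ _]]; exists s; rewrite ss. Qed.

End positive_elements.

(** * Bounds in Hilbert modules and correspondences *)

Section hilbert_module_bounds.
Variables (R : realType) (C : cstarAlgType R) (Y : hilbertModType C).
Local Notation K := R[i].
Implicit Types (x y z : Y) (a c : C).

Lemma ract0r x : ract x (0 : C) = 0.
Proof. by have := ractZr 0 x (0 : C); rewrite !scale0r. Qed.
Lemma ract0l c : ract (0 : Y) c = 0.
Proof. by have := ractZl 0 (0 : Y) c; rewrite !scale0r. Qed.
Lemma ractBr x a c : ract x (a - c) = ract x a - ract x c.
Proof. by rewrite ractDr -scaleN1r ractZr scaleN1r. Qed.
Lemma ractBl x y c : ract (x - y) c = ract x c - ract y c.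
Proof. by rewrite ractDl -scaleN1r ractZl scaleN1r. Qed.

Lemma norm_ract x c : `|ract x c| <= `|x| * `|c|.
Proof.
rewrite -(@ler_pXn2r _ 2) ?nnegrE ?mulr_ge0 // (@norm_inner R C Y).
rewrite inner_ract inner_ractl exprMn (@norm_inner R C Y) expr2.
apply: le_trans (cnormM _ _) _; rewrite mulrA ler_wpM2r // mulrC.
by rewrite -(norm_star c) cnormM.
Qed.

(** Polarization gives the Cauchy-Schwarz inequality up to a constant, which is
    enough for continuity. *)
Lemma norm_inner_le x y : `|inner x y : C| <= 4 * `|x| * `|y|.
Proof.
have [->|x0] := eqVneq x 0; first by rewrite inner0l !normr0 mulr0 mul0r.
have [->|y0] := eqVneq y 0; first by rewrite inner0r !normr0 mulr0.
have nx : 0 < `|x| by rewrite normr_gt0.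
have ny : 0 < `|y| by rewrite normr_gt0.
suff H (u v : Y) : `|u| <= 1 -> `|v| <= 1 -> `|inner u v : C| <= 4.
  have n1 (z : Y) : 0 < `|z| -> `|(`|z|^-1 : K) *: z| <= 1.
    by move=> z0; rewrite normrZ gtr0_norm ?invr_gt0 // mulVf ?gt_eqF.
  have := H _ _ (n1 x nx) (n1 y ny).
  rewrite innerZr innerZl conj_Creal ?gtr0_real ?invr_gt0 // !normrZ.
  rewrite !gtr0_norm ?invr_gt0 // ler_pdivrMl // ler_pdivrMl // => le_xy.
  by apply: le_trans le_xy _; rewrite mulrA mulrC mulrA.
move=> u1 v1; pose P (k : K) : C := inner (u + k *: v) (u + k *: v).
have P4 k : `|k| = 1 -> `|P k| <= 4.
  move=> k1; rewrite /P -(@norm_inner R C Y) (_ : 4 = 2 ^+ 2); last by ring.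
  rewrite lerXn2r ?nnegrE //; apply: le_trans (ler_normD _ _) _.
  by rewrite normrZ k1 mul1r (_ : 2 = 1 + 1) // lerD.
have i2 : 'i * 'i = -1 :> K by rewrite -expr2 sqrCi.
have PE k k' : k^* = k' -> k' * k = 1 ->
    P k = inner u u + k *: inner u v + k' *: inner v u + inner v v.
  move=> kk k1; rewrite /P !innerE kk scalerA mulrC k1 scale1r; lin.
have -> : inner u v =
    4^-1 *: (P 1 - P (-1) - 'i *: P 'i + 'i *: P (- 'i)) :> C.
  rewrite (PE 1 1) ?rmorph1 ?mulr1 //.
  rewrite (PE (-1) (-1)) ?rmorphN1 ?mulrNN ?mulr1 //.
  rewrite (PE 'i (- 'i)) ?conjCi ?mulNr ?i2 ?opprK //.
  have ci : (- 'i)^* = 'i :> K by rewrite rmorphN /= conjCi opprK.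
  rewrite (PE (- 'i) 'i ci) ?mulrN ?i2 ?opprK //.
  by rewrite !scalerDr !scalerA !mulrN i2; lin.
rewrite normrZ gtr0_norm ?invr_gt0 // ler_pdivrMl //.
have -> : 4 * 4 = 4 + 4 + 4 + 4 :> K by ring.
apply: le_trans (ler_normD _ _) (lerD _ _); last first.
  by rewrite normrZ normCi mul1r P4 // normrN normCi.
apply: le_trans (ler_normB _ _) (lerD _ _); last first.
  by rewrite normrZ normCi mul1r P4 // normCi.
by apply: le_trans (ler_normB _ _) (lerD _ _); rewrite P4 ?normrN ?normr1.
Qed.

Lemma innerBr x y z : inner x (y - z) = inner x y - inner x z :> C.
Proof. by rewrite innerDr innerNr. Qed.

Lemma cvg_theta x y (z : nat -> Y) (l : Y) : z @ \oo --> l ->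
  theta x y (z n) @[n --> \oo] --> theta x y l.
Proof.
apply: (@cvg_additive _ _ _ (theta x y) (`|x| * (4 * `|y|))).
- by move=> u v; rewrite /theta innerBr ractBr.
- by rewrite !mulr_ge0.
- move=> u; apply: le_trans (norm_ract _ _) _.
  by rewrite -mulrA ler_wpM2l ?norm_inner_le.
Qed.

Lemma cvg_thetal (x : nat -> Y) y z (l : Y) : x @ \oo --> l ->
  theta (x n) y z @[n --> \oo] --> theta l y z.
Proof.
apply: (@cvg_additive _ _ _ (fun u => theta u y z) `|inner y z : C|) => //.
- by move=> u v; rewrite /theta ractBl.
- by move=> u; rewrite mulrC norm_ract.
Qed.

Lemma adjointP_inj (T S S' : Y -> Y) :
  is_adjoint T S -> is_adjoint T S' -> S = S'.
Proof.
by move=> TS TS'; apply/funext => x; apply: inner_ext => z; rewrite -TS TS'.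
Qed.

Lemma theta_adjoint x y : is_adjoint (theta x y) (theta y x).
Proof. by move=> u v; rewrite /theta !innerE inner_star. Qed.

Lemma inner_ract_self_eq0 x : ract x (inner x x : C) = 0 -> x = 0.
Proof.
move=> xx; apply: inner_eq0; apply: sqr_eq0; first exact: inner_star.
by rewrite -inner_ract xx inner0r.
Qed.

End hilbert_module_bounds.

Lemma closure_cvg (R : realType) (V : normedModType R[i]) (W : set V) (x : V) :
  closure W x -> exists2 w : nat -> V, (forall n, W (w n)) & w @ \oo --> x.
Proof.
move=> Wx; have H n : exists v, W v /\ `|x - v| < 2 / n.+2%:R.
  have r0 : 0 < 2 / n.+2%:R :> R[i] by rewrite divr_gt0.
  have [v [Wv]] := Wx _ (nbhsx_ballx x _ r0).
  by rewrite -ball_normE /= => xv; exists v.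
have [w wP] := choice H; exists w => [n|]; first by have [] := wP n.
apply/cvgrPdist_le => e e0; have [n ltn] := tau_rate ler01 e0.
exists n => // m /= le_nm; apply: le_trans (ltW (wP m).2) _.
apply: le_trans (ltW ltn); rewrite mul1r.
by rewrite ler_wpM2l // lef_pV2 ?posrE // ler_nat.
Qed.

Lemma dense_cvg (R : realType) (V : normedModType R[i]) (W : set V) (x : V) :
  dense W -> exists2 w : nat -> V, (forall n, W (w n)) & w @ \oo --> x.
Proof.
move=> dW; apply: closure_cvg => B; rewrite nbhsE => -[U [oU Ux] UB].
have [|v [Uv Wv]] := dW U _ oU; first by exists x.
by exists v; split=> //; exact: UB.
Qed.

Lemma closed_cvg (R : realType) (V : normedModType R[i]) (W : set V) :
  (forall (w : nat -> V) (l : V),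
     (forall n, W (w n)) -> w @ \oo --> l -> W l) ->
  closed W.
Proof. by move=> W_lim x /closure_cvg[w Ww wx]; exact: W_lim Ww wx. Qed.

Section correspondence_bounds.
Variables (R : realType) (A C : cstarAlgType R) (Y : correspondence A C).
Local Notation K := R[i].
Implicit Types (x y z : Y) (a b c : A).

Lemma lact0l : lact Y (0 : A) = 0.
Proof.
by have := @lactP R A C Y (-1) 0 0; rewrite scaler0 addr0 scaleN1r addNr.
Qed.
Lemma lactZ (k : K) a : lact Y (k *: a) = k *: lact Y a.
Proof. by have := @lactP R A C Y k a 0; rewrite lact0l !addr0. Qed.
Lemma lactD a b : lact Y (a + b) = lact Y a + lact Y b.
Proof. by have := @lactP R A C Y 1 a b; rewrite !scale1r. Qed.
Lemma lactB a b : lact Y (a - b) = lact Y a - lact Y b.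
Proof. by rewrite lactD -scaleN1r lactZ scaleN1r. Qed.
Lemma lact_adj a x y : inner (lact Y (star a) x) y = inner x (lact Y a y) :> C.
Proof. by rewrite lact_star starK. Qed.
Lemma lactPr a (k : K) x y :
  lact Y a (k *: x + y) = k *: lact Y a x + lact Y a y.
Proof. by apply: inner_ext => z; rewrite -lact_adj !innerE !lact_adj. Qed.
Lemma lactBr a x y : lact Y a (x - y) = lact Y a x - lact Y a y.
Proof. by rewrite addrC -scaleN1r lactPr scaleN1r addrC. Qed.
Lemma lact_ract a x (c : C) : lact Y a (ract x c) = ract (lact Y a x) c.
Proof. by apply: inner_ext => z; rewrite -lact_adj !innerE lact_adj. Qed.

Lemma norm_lact a x : `|lact Y a x| <= 2 * `|a| * `|x|.
Proof.
have [u [v [su sv aE uu vv]]] := self_adjoint_parts a.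
have H s : star s = s -> `|lact Y s x| <= `|s| * `|x|.
  rewrite -[`|s|]mul1r.
  apply: (@rep_norm_le R A C Y (@cmul R A) 1 (lact Y) ltr01).
  - by move=> c p q r; rewrite cmulDl cmulZl.
  - exact: cmulA.
  - exact: starM.
  - by move=> p q; rewrite mul1r cnormM.
  - by move=> c p q r; rewrite lactP.
  - by move=> p q r; rewrite lactM.
  - exact: lact_star.
rewrite {1}aE lactD lactZ -mulrA mulr_natl mulr2n.
apply: le_trans (ler_normD _ _) (lerD _ _).
  by apply: le_trans (H u su) _; rewrite ler_wpM2r.
rewrite [X in `|X|](_ : _ = 'i *: lact Y v x) // normrZ normCi mul1r.
by apply: le_trans (H v sv) _; rewrite ler_wpM2r.
Qed.

Lemma cvg_lact a (x : nat -> Y) (l : Y) : x @ \oo --> l ->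
  lact Y a (x n) @[n --> \oo] --> lact Y a l.
Proof.
apply: (@cvg_additive _ _ _ (lact Y a) (2 * `|a|)); first exact: lactBr.
  by rewrite mulr_ge0.
exact: norm_lact.
Qed.

Lemma cvg_lactl (a : nat -> A) (l : A) x : a @ \oo --> l ->
  lact Y (a n) x @[n --> \oo] --> lact Y l x.
Proof.
apply: (@cvg_additive _ _ _ (fun b => lact Y b x) (2 * `|x|)).
- by move=> u v; rewrite lactB.
- by rewrite mulr_ge0.
- by move=> u; rewrite mulrAC norm_lact.
Qed.

Lemma lkerE a : lker Y a <-> forall x, lact Y a x = 0.
Proof. by split=> [a0 x|a0]; [rewrite a0|apply/funext]. Qed.

Lemma lker_star a : lker Y a -> lker Y (star a).
Proof.
move=> /lkerE a0; apply/lkerE => x; apply: inner_ext => z.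
by rewrite -lact_adj starK a0 inner0l inner0r.
Qed.

Lemma lkerM a b : lker Y b -> lker Y (a ** b) /\ lker Y (b ** a).
Proof.
move=> /lkerE b0; split; apply/lkerE => x; by rewrite lactM /= b0 ?lact0.
Qed.

Local Notation N := (annihilator (lker Y)).

Lemma annM a b : N b -> N (a ** b).
Proof. by move=> Nb c c0; rewrite -cmulA Nb // cmul0r. Qed.

Lemma annP (k : K) a b : N a -> N b -> N (k *: a + b).
Proof.
by move=> Na Nb c c0; rewrite cmulDl cmulZl Na // Nb // scaler0 addr0.
Qed.

Lemma annB a b : N a -> N b -> N (a - b).
Proof. by move=> Na Nb; rewrite addrC -scaleN1r; exact: annP. Qed.

Lemma annMr a b : N b -> N (b ** a).
Proof. by move=> Nb c /(lkerM a)[ac _]; rewrite -cmulA Nb. Qed.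

Lemma ann_star a : N a -> N (star a).
Proof.
move=> Na c c0; apply: star_mul_eq0.
rewrite starM starK -cmulA [a ** _]cmulA (_ : a ** star a ** c = 0).
  by rewrite cmul0r.
by rewrite -cmulA Na // ; have [] := lkerM (star a) c0.
Qed.

Lemma ann_cvg (a : nat -> A) (l : A) : (forall n, N (a n)) -> a @ \oo --> l ->
  N l.
Proof.
move=> Na al c c0; apply: (cvg_uniq (fun n => Na n c c0)); last exact: cvg_cst.
by apply: cvg_cmul => //; exact: cvg_cst.
Qed.

(** A selfadjoint ideal meets its annihilator in elements with a a^* = 0. *)
Lemma ann_lker_eq0 a : N a -> lker Y a -> a = 0.
Proof.
move=> Na /lker_star/Na aa; rewrite -(starK a) (_ : star a = 0) ?star0 //.
by apply: star_mul_eq0; rewrite starK.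
Qed.


End correspondence_bounds.

(** * Left inner products *)

Section left_representatives.
Variables (R : realType) (A C : cstarAlgType R) (Y : correspondence A C).
Local Notation K := R[i].
Local Notation N := (annihilator (lker Y)).
Implicit Types (x y z : Y) (a b : A) (c d : C).

(** The left inner product of a Hilbert bimodule takes values in the annihilator
    of the kernel of the left action.  There the action is injective, so that
    this condition determines the value a at (x, y). *)
Definition left_rep x y a := N a /\ lact Y a = theta x y.

Lemma left_rep_uniq x y a b : left_rep x y a -> left_rep x y b -> a = b.
Proof.
move=> [Na ax] [Nb bx]; apply/eqP; rewrite -subr_eq0; apply/eqP.
apply: (@ann_lker_eq0 _ _ _ Y); first exact: annB.
by rewrite /lker /= lactB ax bx subrr.
Qed.

Lemma left_rep_star x y a : left_rep x y a -> left_rep y x (star a).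
Proof.
move=> [Na ax]; split; first exact: ann_star.
apply: adjointP_inj (@lact_star _ _ _ Y a) _; rewrite ax; exact: theta_adjoint.
Qed.

Lemma left_repP (k : K) x y z a b : left_rep x z a -> left_rep y z b ->
  left_rep (k *: x + y) z (k *: a + b).
Proof.
move=> [Na ax] [Nb bx]; split; first exact: annP.
rewrite lactP ax bx; apply/funext => u.
by rewrite /theta ractDl ractZl.
Qed.

Lemma left_rep0 y : left_rep 0 y 0.
Proof.
split; first by move=> b _; exact: cmul0l.
by rewrite lact0l; apply/funext => u; rewrite /theta ract0l.
Qed.

Lemma left_repB x y z a b : left_rep x z a -> left_rep y z b ->
  left_rep (x - y) z (a - b).
Proof.
move=> ax bx; have -> : x - y = (-1) *: y + x by lin.
by have -> : a - b = (-1) *: b + a; [lin|exact: left_repP].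
Qed.

Lemma left_rep_lact (c : A) x y a :
  left_rep x y a -> left_rep (lact Y c x) y (c ** a).
Proof.
move=> [Na ax]; split; first exact: annM.
by rewrite lactM ax; apply/funext => u; rewrite /theta /= lact_ract.
Qed.

Lemma left_rep_mul x y x' y' a b : left_rep x y a -> left_rep x' y' b ->
  left_rep (ract x (inner y x' : C)) y' (a ** b).
Proof.
move=> [Na ax] [Nb bx]; split; first exact: annM.
rewrite lactM ax bx; apply/funext => u.
by rewrite /theta /= inner_ract ractA.
Qed.

Lemma left_rep_ract c x y a :
  left_rep (ract x c) y a <-> left_rep x (ract y (star c)) a.
Proof.
suff E : theta (ract x c) y = theta x (ract y (star c)) by rewrite /left_rep E.
by apply/funext => u; rewrite /theta inner_ractl starK ractA.
Qed.

Section fixed_vector.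
Variables (x : Y).
Hypothesis x_rep : forall c, exists a, left_rep (ract x c) x a.

Let psi_exists : {psi : C -> A | forall c, left_rep (ract x c) x (psi c)}.
Proof. by apply: cid; have [f fP] := choice x_rep; exists f. Qed.
Let psi := sval psi_exists.
Let psiP c : left_rep (ract x c) x (psi c) := svalP psi_exists c.

Let psi_linear (k : K) (c d : C) : psi (k *: c + d) = k *: psi c + psi d.
Proof.
apply: left_rep_uniq (psiP _) _; rewrite ractDr ractZr.
exact: left_repP (psiP _) (psiP _).
Qed.

Let psi_mul (c d : C) : psi (c ** inner x x ** d) = psi c ** psi d.
Proof.
apply: left_rep_uniq (psiP _) _; rewrite -cmulA ractA -inner_ract.
exact: left_rep_mul (psiP _) (psiP _).
Qed.

Let psi_star (c : C) : star (psi c) = psi (star c).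
Proof.
apply: left_rep_uniq (left_rep_star (psiP c)) _.
by have /left_rep_ract := psiP (star c); rewrite starK.
Qed.

Let norm_psi (c : C) : star c = c -> `|psi c| <= `|x| ^+ 2 * `|c|.
Proof.
move=> sc; have [x0|x0] := eqVneq x 0.
  have -> : psi c = 0.
    by apply: left_rep_uniq (psiP c) _; rewrite x0 ract0l; exact: left_rep0.
  by rewrite normr0 mulr_ge0 ?exprn_ge0.
apply: norm_le_mul => [|z]; first by rewrite mulr_ge0 ?exprn_ge0.
apply: (@rep_norm_le R C A (regular A)
  (fun c d => c ** inner x x ** d) (`|x| ^+ 2)
  (fun c (z : regular A) => psi c ** z)).
- by rewrite exprn_gt0 // normr_gt0.
- by move=> k p q r; rewrite !cmulDl !cmulZl.
- by move=> p q r; rewrite !cmulA.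
- by move=> p q; rewrite !starM inner_star cmulA.
- move=> p q; apply: le_trans (cnormM _ _) _; rewrite ler_wpM2r //.
  by apply: le_trans (cnormM _ _) _; rewrite mulrC (@norm_inner R C Y).
- by move=> k p q r; rewrite psi_linear cmulDl cmulZl.
- by move=> p q r; rewrite psi_mul -cmulA.
- move=> p u v; change (star (psi p ** (u : A)) ** v =
    star (u : A) ** (psi (star p) ** (v : A))).
  by rewrite starM cmulA psi_star.
- exact: sc.
Qed.

(** The Cauchy-Schwarz inequality for the left inner product.  It is enough to
    bound a a^*, which is the value at c = <y, y> of the map psi sending c to
    the representative of (x c, x).  This map is a representation of the algebra
    C with the product c <x, x> d, whence a bound with the factor |x| ^ 2. *)
Lemma left_rep_norm y a : left_rep x y a -> `|a| <= `|x| * `|y|.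
Proof.
move=> ax; rewrite -(@ler_pXn2r _ 2) ?nnegrE ?mulr_ge0 //.
rewrite -norm_star -cnorm_star starK.
rewrite (_ : a ** star a = psi (inner y y : C)); last first.
  exact: left_rep_uniq (left_rep_mul ax (left_rep_star ax)) (psiP _).
by rewrite exprMn (@norm_inner R C Y y) norm_psi ?inner_star.
Qed.

(** With s the square root of <x, x>, the cube of the representative a of
    (x, x) is the square of the representative of (x s, x). *)
Lemma left_rep_positive a : left_rep x x a -> positive a.
Proof.
move=> ax; have [d xx] := inner_ge0 x.
have [s [ss s2 _ _]] := positive_sqrt (positive_star_mul d).
rewrite -xx in s2.
apply: (@positive_of_cube _ _ _ (psi s)).
- exact: left_rep_uniq (left_rep_star ax) ax.
- by rewrite psi_star ss.
- apply: left_rep_uniq (left_rep_mul (psiP s) ax) _.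
  have := left_rep_mul ax (psiP s).
  by rewrite inner_ract -ractA -s2 cmulA.
- apply: left_rep_uniq (left_rep_mul (left_rep_mul ax ax) ax) _.
  have := left_rep_mul (psiP s) (psiP s).
  by rewrite inner_ract -!ractA -s2 !cmulA.
Qed.

End fixed_vector.

Lemma left_rep_cvg (x : nat -> Y) y l (a : nat -> A) b :
  (forall n, left_rep (x n) y (a n)) -> x @ \oo --> l -> a @ \oo --> b ->
  left_rep l y b.
Proof.
move=> xa xl ab; split; first by apply: ann_cvg ab => n; have [] := xa n.
apply/funext => z; have E n : lact Y (a n) z = theta (x n) y z.
  by have [_ ->] := xa n.
exact: (cvg_uniq E (cvg_lactl ab) (cvg_thetal xl)).
Qed.

Section dense_extension.
Variable W : set Y.
Hypotheses (dW : dense W) (WB : forall x y, W x -> W y -> W (x - y))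
  (W_ract : forall x (c : C), W x -> W (ract x c))
  (W_rep : forall x y, W x -> W y -> exists a, left_rep x y a).

(** By left_rep_norm, the representatives of pairs (w n, y) form a Cauchy
    sequence when w n converges to x. *)
Let extend_left y : (forall x, W x -> exists a, left_rep x y a) ->
  forall x, exists a, left_rep x y a.
Proof.
move=> W_y x; have [w Ww wx] := dense_cvg x dW.
have [a aP] := choice (fun n => W_y (w n) (Ww n)).
have aB n p : `|a n - a p| <= `|y| * `|w n - w p|.
  rewrite mulrC; apply: left_rep_norm (left_repB (aP n) (aP p)) => c.
  by apply: W_rep; [apply: W_ract|]; apply: WB.
suff: cvg (a @ \oo).
  by move=> /cvg_ex[l al]; exists l; exact: left_rep_cvg aP wx al.
apply/cauchy_cvgP/cauchy_exP => e e0.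
have y1 : 0 < `|y| + 1 by rewrite ltr_wpDl.
have e1 : 0 < e / (`|y| + 1) / 2 by rewrite !divr_gt0.
have /cvgrPdist_lt/(_ _ e1)[n _ wn] := wx.
exists (a n); exists n => // p /= le_np; rewrite -ball_normE /=.
apply: le_lt_trans (aB _ _) _.
have w2 : `|w n - w p| < e / (`|y| + 1).
  rewrite (_ : w n - w p = (x - w p) - (x - w n)); last by lin.
  rewrite [ltRHS]splitr; apply: le_lt_trans (ler_normB _ _) (ltrD _ _).
    exact: wn.
  exact: wn (leqnn n).
apply: le_lt_trans (_ : (`|y| + 1) * `|w n - w p| < _).
  by rewrite ler_wpM2r // lerDl.
by rewrite mulrC -ltr_pdivlMr.
Qed.

Lemma left_rep_dense x y : exists a, left_rep x y a.
Proof.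
apply: extend_left => {}x Wx.
suff [a ax] : exists a, left_rep y x a.
  by exists (star a); exact: left_rep_star.
apply: extend_left => {}y Wy; exact: W_rep.
Qed.

End dense_extension.

End left_representatives.

Section hilbert_bimodules.
Variables (R : realType) (A : cstarAlgType R) (X : correspondence A A).
Local Notation K := R[i].

Lemma hilbert_bimodule_left_rep (f : X -> X -> A) :
  (forall x y, star (f x y) = f y x) ->
  (forall a x y, f (lact X a x) y = a ** f x y) ->
  (forall x y z, lact X (f x y) z = ract x (inner y z : A)) ->
  (forall (c : K) x y z, f (c *: x + y) z = c *: f x z + f y z) ->
  forall x y, left_rep x y (f x y).
Proof.
move=> f_star f_lact f_theta f_lin x y; split; last exact/funext/f_theta.
move=> b /lker_star/lkerE b0; rewrite -[LHS]starK starM f_star -f_lact b0.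
have f0 z : f 0 z = 0.
  by have := f_lin (-1) 0 0 z; rewrite scaler0 addr0 scaleN1r addNr.
by rewrite f0 star0.
Qed.

(** All the axioms of a left inner product but positivity follow from the
    uniqueness of representatives. *)
Lemma hilbert_bimoduleP :
  hilbert_bimodule X <-> forall x y : X, exists a, left_rep x y a.
Proof.
split=> [[f [f_lin f_star _ f_lact f_theta]] x y|X_rep].
  by exists (f x y); exact: hilbert_bimodule_left_rep.
have [f fP] : exists f : X -> X -> A, forall x y, left_rep x y (f x y).
  have [g gP] := choice (fun u : X * X => X_rep u.1 u.2).
  by exists (fun x y => g (x, y)) => x y; exact: gP (x, y).
exists f; split=> [c x y z|x y|x|a x y|x y z].
- exact: left_rep_uniq (fP _ _) (left_repP c (fP _ _) (fP _ _)).
- exact: left_rep_uniq (left_rep_star (fP _ _)) (fP _ _).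
- by apply: positive_cpositive; apply: left_rep_positive (fP x x).
- exact: left_rep_uniq (fP _ _) (left_rep_lact a (fP _ _)).
- by have [_ ->] := fP x y.
Qed.

End hilbert_bimodules.

(** * Compact operators and the Katsura ideal *)

Section linear_span.
Variables (K : pzRingType) (V : lmodType K).
Implicit Types (S : set V) (x y : V).

Lemma lspanP S (k : K) x y : lspan S x -> lspan S y -> lspan S (k *: x + y).
Proof.
move=> [n [c [u [Su ->]]]] [m [d [v [Sv ->]]]]; exists (n + m)%N.
exists (fun i : 'I_(n + m) =>
  match fintype.split i with inl j => k * c j | inr j => d j end).
exists (fun i : 'I_(n + m) =>
  match fintype.split i with inl j => u j | inr j => v j end).
split=> [i|]; first by case: (fintype.split i).
rewrite big_split_ord /= scaler_sumr; congr (_ + _); apply: eq_bigr => i _.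
  by rewrite (unsplitK (inl i)) scalerA.
by rewrite (unsplitK (inr i)).
Qed.

Lemma lspan_ind S (P : V -> Prop) : P 0 ->
  (forall k x y, S x -> P y -> P (k *: x + y)) -> forall x, lspan S x -> P x.
Proof.
move=> P0 PD x [n [c [u [Su ->]]]]; elim: n c u Su => [|n IH] c u Su.
  by rewrite big_ord0.
by rewrite big_ord_recl; apply: PD => //; exact: IH.
Qed.

Lemma lspan0 S : lspan S 0.
Proof.
by exists 0%N, (fun=> 0), (fun=> 0); split=> [[]//|]; rewrite big_ord0.
Qed.

Lemma lspan_mem S x : S x -> lspan S x.
Proof.
move=> Sx; exists 1%N, (fun=> 1), (fun=> x); split=> //.
by rewrite big_ord1 scale1r.
Qed.

End linear_span.

Section compact_operators.
Variables (R : realType) (C : cstarAlgType R) (Y : hilbertModType C).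
Local Notation K := R[i].
Implicit Types (T S : Y -> Y).

Definition rank_one : set (Y -> Y) := [set T | exists x y, T = theta x y].

Lemma theta_compact (x y : Y) : @compact_ops R C Y (theta x y).
Proof.
split; first by exists (theta y x); exact: theta_adjoint.
move=> e e0; exists (theta x y); first by apply: lspan_mem; exists x, y.
by move=> z; rewrite subrr normr0 mulr_ge0 // ltW.
Qed.

Lemma compactP (k : K) T S : @compact_ops R C Y T -> @compact_ops R C Y S ->
  @compact_ops R C Y (k *: T + S).
Proof.
move=> [[T' TT'] cT] [[S' SS'] cS]; split.
  exists (k^* *: T' + S') => x y.
  by rewrite !fctE !innerE TT' SS'.
move=> e e0.
have k1 : 0 < `|k| + 1 by rewrite ltr_wpDl.
have e1 : 0 < e / 2 / (`|k| + 1) by rewrite !divr_gt0.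
have e2 : 0 < e / 2 by rewrite divr_gt0.
have [U sU TU] := cT _ e1; have [V sV SV] := cS _ e2.
exists (k *: U + V); first exact: lspanP.
move=> z; rewrite !fctE.
have -> : k *: T z + S z - (k *: U z + V z) = k *: (T z - U z) + (S z - V z).
  by lin.
apply: le_trans (ler_normD _ _) _; rewrite [e in leRHS]splitr mulrDl lerD //.
rewrite normrZ.
apply: le_trans (_ : (`|k| + 1) * (e / 2 / (`|k| + 1) * `|z|) <= _).
  by rewrite ler_pM // lerDl.
by rewrite mulrA [_ * (e / 2 / _)]mulrC divfK // gt_eqF.
Qed.

End compact_operators.

Section compact_left_action.
Variables (R : realType) (A C : cstarAlgType R) (Y : correspondence A C).
Local Notation K := R[i].
Implicit Types (x y z : Y) (a b : A).

Lemma lact_adjointable a : adjointable (lact Y a).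
Proof. by exists (lact Y (star a)); exact: lact_star. Qed.

Lemma lact_compactP (k : K) a b : lact_compact Y a -> lact_compact Y b ->
  lact_compact Y (k *: a + b).
Proof. by rewrite /lact_compact /= lactP; exact: compactP. Qed.

Lemma lact_compact0 : lact_compact Y 0.
Proof.
rewrite /lact_compact /= lact0l -(_ : theta (0 : Y) 0 = 0).
  exact: theta_compact.
by apply/funext => x; rewrite /theta ract0l.
Qed.

Lemma lact_compactMl a b : lact_compact Y b -> lact_compact Y (a ** b).
Proof.
move=> [_ cb]; split; first exact: lact_adjointable.
move=> e e0; have M1 : 0 < 2 * `|a| + 1 by rewrite ltr_wpDl ?mulr_ge0.
have e1 : 0 < e / (2 * `|a| + 1) by rewrite divr_gt0.
have [U sU bU] := cb _ e1; exists (lact Y a \o U).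
  move: U sU {bU}; apply: (@lspan_ind _ _ _
      (fun U => lspan (@rank_one R C Y) (lact Y a \o U))).
    rewrite (_ : _ \o _ = 0); first exact: lspan0.
    by apply/funext => z; rewrite /= [LHS]lact0.
  move=> k _ V [x [y ->]] sV; rewrite (_ : _ \o _ =
    k *: theta (lact Y a x) y + (lact Y a \o V)).
    by apply: lspanP => //; apply: lspan_mem; exists (lact Y a x), y.
  by apply/funext => z; rewrite /= !fctE lactPr /theta lact_ract.
move=> z; rewrite lactM /= -lactBr; apply: le_trans (norm_lact _ _) _.
apply: le_trans (_ : (2 * `|a| + 1) * (e / (2 * `|a| + 1) * `|z|) <= _).
  by rewrite ler_pM ?mulr_ge0 // lerDl.
by rewrite mulrA [_ * (e / _)]mulrC divfK // gt_eqF.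
Qed.

Lemma lact_compactMr a b : lact_compact Y b -> lact_compact Y (b ** a).
Proof.
move=> [_ cb]; split; first exact: lact_adjointable.
move=> e e0; have M1 : 0 < 2 * `|a| + 1 by rewrite ltr_wpDl ?mulr_ge0.
have e1 : 0 < e / (2 * `|a| + 1) by rewrite divr_gt0.
have [U sU bU] := cb _ e1; exists (U \o lact Y a).
  move: U sU {bU}; apply: (@lspan_ind _ _ _
      (fun U => lspan (@rank_one R C Y) (U \o lact Y a))).
    by rewrite (_ : _ \o _ = 0) //; exact: lspan0.
  move=> k _ V [x [y ->]] sV; rewrite (_ : _ \o _ =
    k *: theta x (lact Y (star a) y) + (V \o lact Y a)).
    by apply: lspanP => //; apply: lspan_mem; exists x, (lact Y (star a) y).
  by apply/funext => z; rewrite /= !fctE /theta lact_adj.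
move=> z; rewrite lactM /=; apply: le_trans (bU _) _.
apply: le_trans (_ : e / (2 * `|a| + 1) * ((2 * `|a| + 1) * `|z|) <= _).
  rewrite ler_wpM2l ?(ltW e1) //; apply: le_trans (norm_lact _ _) _.
  by rewrite ler_wpM2r // lerDl.
by rewrite mulrA divfK // gt_eqF.
Qed.

Lemma lact_compact_cvg (a : nat -> A) (l : A) :
  (forall n, lact_compact Y (a n)) -> a @ \oo --> l -> lact_compact Y l.
Proof.
move=> ca al; split; first exact: lact_adjointable.
move=> e e0; have e4 : 0 < e / 4 by rewrite divr_gt0.
have e2 : 0 < e / 2 by rewrite divr_gt0.
move/cvgrPdist_le/(_ _ e4): al => al.
have [n /= le_n] := filter_ex al; have [_ cn] := ca n.
have [U sU aU] := cn _ e2; exists U => // z.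
have -> : lact Y l z - U z = lact Y (l - a n) z + (lact Y (a n) z - U z).
  by rewrite lactB !fctE; lin.
apply: le_trans (ler_normD _ _) _; rewrite [e in leRHS]splitr mulrDl lerD //.
apply: le_trans (norm_lact _ _) _; rewrite ler_wpM2r //.
apply: le_trans (_ : 2 * (e / 4) <= _); first by rewrite ler_wpM2l.
by rewrite (_ : 2 * (e / 4) = e / 2) //; field.
Qed.

Lemma katsura_closed_ideal : closed_ideal (katsura_ideal Y).
Proof.
split=> [|k a b [Na ca] [Nb cb]|a b [Nb cb]|a b [Nb cb]|].
- by split; [move=> b _; exact: cmul0l|exact: lact_compact0].
- by split; [exact: annP|exact: lact_compactP].
- by split; [exact: annM|exact: lact_compactMl].
- by split; [exact: annMr|exact: lact_compactMr].
- apply: closed_cvg => w l Ww wl; split.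
    by apply: ann_cvg wl => n; have [] := Ww n.
  by apply: lact_compact_cvg wl => n; have [] := Ww n.
Qed.

(** A nonzero a moves some vector z, and a [z, z] = [a z, z] is nonzero and
    acts as an operator of rank one. *)
Lemma katsura_essential : (forall a, lker Y a -> a = 0) ->
  (forall x y, exists a, left_rep x y a) ->
  forall I : set A, closed_ideal I -> I <> [set 0] ->
    I `&` katsura_ideal Y <> [set 0].
Proof.
move=> inj Y_rep I [I0 _ _ I_r _] Inz IJ0; apply: Inz.
apply/seteqP; split=> [a Ia /=|_ ->//].
apply: inj; apply/lkerE => z.
have [b zb] := Y_rep z z; have [Nab abE] := left_rep_lact a zb.
have ab0 : a ** b = 0.
  suff : (I `&` katsura_ideal Y) (a ** b) by rewrite IJ0.
  split; first exact: I_r.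
  by split=> //; rewrite /lact_compact /= abE; exact: theta_compact.
apply: inner_ract_self_eq0; rewrite lact_star.
have /(congr1 (@^~ (lact Y (star a) (lact Y a z)))) := abE.
by rewrite ab0 lact0l.
Qed.

End compact_left_action.

Section isometry_on_span.
Variables (R : realType) (A C : cstarAlgType R) (Y : correspondence A C).
Local Notation K := R[i].
Local Notation N := (annihilator (lker Y)).
Implicit Types (x y z : Y) (a b : A).

Definition op_le (T : Y -> Y) (e : K) : Prop := forall z, `|T z| <= e * `|z|.

Lemma op_le_star a e : 0 <= e -> op_le (lact Y a) e ->
  op_le (lact Y (star a)) (4 * e).
Proof.
move=> e0 ae z; set w := lact Y (star a) z.
have [w0|w0] := eqVneq w 0; first by rewrite w0 normr0 !mulr_ge0.
rewrite -(@ler_pM2r _ `|w|) ?normr_gt0 // -expr2 (@norm_inner R C Y).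
rewrite {1}/w lact_adj; apply: le_trans (norm_inner_le _ _) _.
rewrite (_ : 4 * e * _ * _ = 4 * `|z| * (e * `|w|)); last by ring.
by rewrite ler_wpM2l ?mulr_ge0 // ae.
Qed.

(** The bound involves c only through the operator by which it acts; it is known
    beforehand for sums of values of a left inner product. *)
Definition left_bounded a := exists2 M : K, 0 <= M &
  forall c, op_le (lact Y c) 1 -> `|c ** a| <= M.

Lemma left_boundedP (k : K) a b :
  left_bounded a -> left_bounded b -> left_bounded (k *: a + b).
Proof.
move=> [M M0 aM] [M' M'0 bM']; exists (`|k| * M + M').
  by rewrite addr_ge0 ?mulr_ge0.
move=> c c1; rewrite cmulDr cmulZr; apply: le_trans (ler_normD _ _) _.
by rewrite normrZ lerD ?ler_wpM2l ?aM ?bM'.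
Qed.

(** If r 0 = 1 + d with d > 0, then r n >= 1 + (n + 1) d. *)
Lemma pow2_bounded (r : nat -> K) (M : K) : (forall n, 0 <= r n) ->
  (forall n, r n.+1 = r n ^+ 2) -> (forall n, r n <= M) -> r 0%N <= 1.
Proof.
move=> r0 rS rM.
have rr n : r n \is Num.real by rewrite ger0_real.
rewrite real_leNgt ?rr ?real1 //; apply/negP => r1.
pose d := r 0%N - 1; have d0 : 0 < d by rewrite subr_gt0.
have growth n : 1 + n.+1%:R * d <= r n.
  elim: n => [|n IH]; first by rewrite mul1r addrC subrK.
  have nd : 0 <= n.+1%:R * d by rewrite mulr_ge0 // ltW.
  apply: le_trans (_ : (1 + n.+1%:R * d) ^+ 2 <= _); last first.
    by rewrite rS lerXn2r ?nnegrE // addr_ge0.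
  rewrite -subr_ge0 -(natr1 n.+1).
  have -> : (1 + n.+1%:R * d) ^+ 2 - (1 + (n.+1%:R + 1) * d) =
     (n.+1%:R - 1) * d + (n.+1%:R * d) ^+ 2 by ring.
  rewrite addr_ge0 ?exprn_ge0 //; apply: mulr_ge0; last exact: ltW.
  by rewrite subr_ge0 ler1n.
have M0 : 0 <= M := le_trans (r0 0%N) (rM 0%N).
have d2 : 0 < 2 * d by rewrite mulr_gt0.
have [n] := tau_rate M0 d2.
rewrite mulrCA ltr_pM2l // ltr_pdivrMr // mulrC => ltM.
have := le_lt_trans (le_trans (growth n.+1) (rM _)) ltM.
by rewrite gtrDr ltr10.
Qed.

(** The power of a^* a with exponent 2 ^ n is c n a, where c n acts as a
    contraction.  So its norm, which is that of a^* a raised to the power 2 ^ n,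
    is bounded independently of n.  By op_le_star, the bound 4^-1 for a makes
    a^* a contraction too. *)
Lemma left_bounded_norm a :
  left_bounded a -> op_le (lact Y a) 4^-1 -> `|a| <= 1.
Proof.
move=> [M M0 aM] a4; have a4s : op_le (lact Y (star a)) 1.
  rewrite -[X in op_le _ X](@divff _ 4) ?pnatr_eq0 //.
  by apply: op_le_star; rewrite ?invr_ge0.
pose c := fix c n := if n is n'.+1 then c n' ** a ** c n' else star a.
have c1 n : op_le (lact Y (c n)) 1.
  elim: n => [|n IH] //= z; rewrite !lactM /=; apply: le_trans (IH _) _.
  rewrite mul1r; apply: le_trans (a4 _) _; rewrite ler_pdivrMl //.
  by apply: le_trans (IH _) _; rewrite ler_peMl ?mulr_ge0 // ler1n.
have c_star n : star (c n ** a) = c n ** a.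
  elim: n => [|n IH] /=; first by rewrite starM starK.
  by rewrite -cmulA starM IH.
have /(pow2_bounded _): forall n, `|c n ** a| <= M by move=> n; exact: aM.
move=> /(_ (fun _ => normr_ge0 _)) H.
have: `|c 0%N ** a| <= 1.
  by apply: H => n; rewrite -cnorm_star c_star /= cmulA.
by rewrite /= cnorm_star expr_le1.
Qed.

(** On such elements the left action is bounded below, so that norm limits of
    the operators come from limits in the algebra. *)
Lemma left_bounded_norm_le a (e : K) : 0 < e ->
  left_bounded a -> op_le (lact Y a) e -> `|a| <= 4 * e.
Proof.
move=> e0 ba ae; have e4 : 0 < (4 * e)^-1 by rewrite invr_gt0 mulr_gt0.
rewrite -[leRHS]mulr1 -ler_pdivrMl ?mulr_gt0 //.
rewrite -[X in X * _]gtr0_norm // -normrZ; apply: left_bounded_norm.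
  rewrite -[_ *: a]addr0; apply: left_boundedP => //.
  by exists 0 => // c _; rewrite cmul0r normr0.
move=> z; rewrite lactZ fctE normrZ gtr0_norm // ler_pdivrMl ?mulr_gt0 //.
by have -> : 4 * e * (4^-1 * `|z|) = e * `|z| by field.
Qed.

Hypothesis Y_rep : forall x y, exists a, left_rep x y a.

Lemma left_rep_bounded x y a : left_rep x y a -> left_bounded a.
Proof.
move=> xa; exists (`|x| * `|y|) => [|c c1]; first exact: mulr_ge0.
apply: le_trans (left_rep_norm (fun=> Y_rep _ _) (left_rep_lact c xa)) _.
by rewrite ler_wpM2r //; have := c1 x; rewrite mul1r.
Qed.

Lemma span_rank_one_lact T : lspan (@rank_one R C Y) T ->
  exists a, [/\ N a, lact Y a = T & left_bounded a].
Proof.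
move: T; apply: lspan_ind.
  exists 0; split; [by move=> b _; exact: cmul0l|exact: lact0l|].
  by exists 0 => // c _; rewrite cmul0r normr0.
move=> k _ T [x [y ->]] [a [Na <- ba]]; have [b xyb] := Y_rep x y.
have [Nb bE] := xyb; exists (k *: b + a); split; first exact: annP.
  by rewrite lactP bE.
by apply: left_boundedP => //; exact: left_rep_bounded xyb.
Qed.

(** If all operators of rank one come from the ideal orthogonal to the kernel,
    then so do all compact operators. *)
Lemma compact_lact_katsura a : lact_compact Y a ->
  exists2 b, katsura_ideal Y b & lact Y b = lact Y a.
Proof.
move=> ca; have [_ cla] := ca.
have e0 n : 0 < 2 / n.+2%:R :> K by rewrite divr_gt0.
have H n : exists b, [/\ N b, left_bounded b &
    forall z, `|lact Y a z - lact Y b z| <= 2 / n.+2%:R * `|z|].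
  have [T /span_rank_one_lact[b [Nb <- bb]] aT] := cla _ (e0 n).
  by exists b.
have [b bP] := choice H.
have bcauchy n m : (n <= m)%N ->
    `|b n - b m| <= 4 * (2 / n.+2%:R + 2 / n.+2%:R).
  move=> le_nm; have [[_ bn an] [_ bm am]] := (bP n, bP m).
  apply: left_bounded_norm_le; first exact: addr_gt0.
    rewrite addrC -scaleN1r; exact: left_boundedP.
  move=> z; rewrite lactB fctE.
  have -> : lact Y (b n) z - lact Y (b m) z =
    (lact Y a z - lact Y (b m) z) - (lact Y a z - lact Y (b n) z) by lin.
  apply: le_trans (ler_normB _ _) _; rewrite mulrDl lerD //.
  apply: le_trans (am z) _; rewrite ler_wpM2r // ler_wpM2l //.
  by rewrite lef_pV2 ?posrE // ler_nat.
have [l bl] : exists l : A, b @ \oo --> l.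
  suff: cvg (b @ \oo) by move=> /cvg_ex.
  apply/cauchy_cvgP/cauchy_exP => e ep; have e8 : 0 < e / 8 by rewrite divr_gt0.
  have [n ltn] := tau_rate ler01 e8; exists (b n); exists n => // m /= le_nm.
  rewrite -ball_normE /=; apply: le_lt_trans (bcauchy _ _ le_nm) _.
  rewrite (_ : 4 * _ = 8 * (1 * (2 / n.+2%:R))); last by ring.
  by rewrite mulrC -ltr_pdivlMr.
have lE : lact Y l = lact Y a.
  apply/funext => z.
  apply: (cvg_unique (@norm_hausdorff _ Y) (cvg_lactl bl)).
  apply/cvgrPdist_le => e ep.
  have [n ltn] := tau_rate (normr_ge0 z) ep.
  exists n => // m /= le_nm; have [_ _ am] := bP m.
  apply: le_trans (am z) _; apply: le_trans (ltW ltn).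
  rewrite mulrC ler_wpM2l // ler_wpM2l //.
  by rewrite lef_pV2 ?posrE // ler_nat.
exists l => //; split; last by rewrite /lact_compact /= lE.
by apply: ann_cvg bl => n; have [] := bP n.
Qed.

End isometry_on_span.

(** * Coordinates in a graph correspondence *)

Section transport.
Variable R : realType.

Definition cast_alg (B B' : cstarAlgType R) (hB : B = B') : B -> B' :=
  let: erefl := hB in id.

Definition cast_vec (B B' C C' : cstarAlgType R) (hB : B = B') (hC : C = C')
    (Y : correspondence B C) : Y -> corr_cast hB hC Y :=
  let: erefl as hB' := hB return Y -> corr_cast hB' hC Y in
  let: erefl as hC' := hC return Y -> corr_cast erefl hC' Y in id.

Variables (B B' C C' : cstarAlgType R) (hB : B = B') (hC : C = C').
Variable Y : correspondence B C.
Local Notation J := (@cast_vec B B' C C' hB hC Y).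

Lemma cast_vec_surj z : exists y, z = J y.
Proof. by move: z; case: B' / hB; case: C' / hC => z; exists z. Qed.
Lemma cast_vec_inj : injective J.
Proof. by case: B' / hB; case: C' / hC. Qed.
Lemma cast_vec0 : J 0 = 0.
Proof. by case: B' / hB; case: C' / hC. Qed.
Lemma cast_vec_lact b y :
  J (lact Y b y) = lact (corr_cast hB hC Y) (cast_alg hB b) (J y).
Proof. by case: B' / hB; case: C' / hC. Qed.
Lemma cast_vec_ract y c : J (ract y c) = ract (J y) (cast_alg hC c).
Proof. by case: B' / hB; case: C' / hC. Qed.
Lemma cast_vec_inner x y : inner (J x) (J y) = cast_alg hC (inner x y) :> C'.
Proof. by case: B' / hB; case: C' / hC. Qed.
Lemma corr_cast_full : full_module (corr_cast hB hC Y) -> full_module Y.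
Proof. by case: B' / hB; case: C' / hC. Qed.
End transport.

Section completed_graph_correspondence.
Variables (R : realType) (D : graph_data R).
Local Notation K := R[i].
Local Notation AG := (graph_algebra D).
Implicit Types (p q : vertex D) (e f g : edge D).

Lemma c0_sum_eq (a b : AG) : (forall p, a p = b p) -> a = b.
Proof. by move=> ab; apply/val_inj/functional_extensionality_dep. Qed.

Lemma c00_eq (u v : c00 D) : (forall e, u e = v e) -> u = v.
Proof. by move=> uv; apply/val_inj/functional_extensionality_dep. Qed.

Lemma eq_alg_cast p q (h : p = q) (x : AG) :
  x q = cast_alg (congr1 (@valg R D) h) (x p).
Proof. by case: q / h. Qed.

Lemma dfwith_cast p q (h : p = q) (x : valg p) :
  dfwith (fun r => 0 : valg r) x q = cast_alg (congr1 (@valg R D) h) x.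
Proof. by case: q / h; rewrite dfwith_in. Qed.

Fact point_subproof p (a : valg p) :
  (dfwith (fun r => 0 : valg r) a : family (@valg R D)) \in @vanishing R _ _.
Proof.
apply/asboolP => eps eps0; apply: (@sub_finite_set _ _ [set p]) => // q /=.
have [->//|qp] := eqVneq q p.
by rewrite /family_fun dfwith_out 1?eq_sym // normr0 lt_geF.
Qed.
Definition point p (a : valg p) : AG := C0Sum (point_subproof a).

Lemma point_in p (a : valg p) : point a p = a.
Proof. exact: dfwith_in. Qed.
Lemma point_out p q (a : valg p) : p != q -> point a q = 0.
Proof. exact: dfwith_out. Qed.

Fact delta_subproof e (x : ecorr e) :
  (dfwith (fun f => 0 : ecorr f) x : family (@ecorr R D))
    \in @finitely_supported R D.
Proof.
apply/asboolP; apply: (@sub_finite_set _ _ [set e]) => // f /=.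
have [->//|fe] := eqVneq f e.
by rewrite /family_fun dfwith_out 1?eq_sym // eqxx.
Qed.
Definition delta e (x : ecorr e) : c00 D := C00 (delta_subproof x).

Lemma delta_in e (x : ecorr e) : delta x e = x.
Proof. exact: dfwith_in. Qed.
Lemma delta_out e f (x : ecorr e) : e != f -> delta x f = 0.
Proof. exact: dfwith_out. Qed.

Lemma graph_lact_delta (x : AG) e (u : ecorr e) :
  graph_lact x (delta u) = delta (lact (ecorr e) (x (rng e)) u).
Proof.
apply: c00_eq => f; rewrite -[LHS]/(lact (ecorr f) (x (rng f)) (delta u f)).
have [->|fe] := eqVneq f e; first by rewrite !delta_in.
by rewrite !delta_out 1?eq_sym // lact0.
Qed.

Lemma graph_ract_delta (x : AG) e (u : ecorr e) :
  graph_ract (delta u) x = delta (ract u (x (src e))).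
Proof.
apply: c00_eq => f; rewrite -[LHS]/(ract (delta u f) (x (src f))).
have [->|fe] := eqVneq f e; first by rewrite !delta_in.
by rewrite !delta_out 1?eq_sym // ract0l.
Qed.

Lemma graph_inner_delta f (y : ecorr f) (v : c00 D) p :
  graph_inner (delta y) v p = dfwith (fun q => 0 : valg q) (inner y (v f)) p.
Proof.
have dfwith0 e : dfwith (fun q => 0 : valg q) (0 : valg (src e)) p = 0.
  by case: dfwithP.
have off e : f != e ->
    dfwith (fun q => 0 : valg q) (inner (delta y e) (v e)) p = 0.
  by move=> fe; rewrite delta_out // inner0l.
rewrite /graph_inner; have [fp|fp] := eqVneq (src f) p; last first.
  rewrite dfwith_out // fsbig1 // => e /= ep; apply: off.
  by apply: contra_neq fp => ->.
rewrite -(@fsbig_widen _ _ _ _ [set f]) ?fsbig_set1 ?delta_in //.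
  by move=> _ ->.
by move=> e /= [_ /eqP]; rewrite eq_sym => fe; exact: off.
Qed.

Variable Y : correspondence AG AG.
Variable iota : {linear c00 D -> Y}.
Hypotheses (iota_inner : forall u v p,
    (inner (iota u) (iota v) : AG) p = graph_inner u v p)
  (iota_dense : dense (range iota))
  (iota_ract : forall u x, iota (graph_ract u x) = ract (iota u) x)
  (iota_lact : forall x u, iota (graph_lact x u) = lact Y x (iota u)).

Lemma inner_delta f (y : ecorr f) v p : (inner (iota (delta y)) (iota v) : AG) p
  = dfwith (fun q => 0 : valg q) (inner y (v f)) p.
Proof. by rewrite iota_inner graph_inner_delta. Qed.

Lemma iota_inj : injective iota.
Proof.
move=> u v uv; apply: c00_eq => e; apply: inner_ext => z.
have := congr1 (fun y => (inner (iota (delta z)) y : AG) (src e)) uv.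
by rewrite !inner_delta !dfwith_in.
Qed.

(** Both sides are continuous, so that it is enough to compare their coordinates
    on the dense image of c00. *)
Lemma lact_theta_delta (a : AG) e f (x : ecorr e) (y : ecorr f) :
  (forall v g, lact (ecorr g) (a (rng g)) (v g) =
    ract (delta x g) (dfwith (fun q => 0 : valg q) (inner y (v f)) (src g))) ->
  lact Y a = theta (iota (delta x)) (iota (delta y)).
Proof.
move=> axy; apply/funext => z; have [w Ww wz] := dense_cvg z iota_dense.
apply: (cvg_uniq _ (cvg_lact wz) (cvg_theta wz)) => n.
have [v _ <-] := Ww n; rewrite /theta -iota_lact -iota_ract; congr (iota _).
apply: c00_eq => g; rewrite -[LHS]/(lact (ecorr g) (a (rng g)) (v g)).
by rewrite axy -inner_delta.
Qed.

Lemma lker_edges (a : AG) e : lker Y a -> lker (ecorr e) (a (rng e)).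
Proof.
move=> /lkerE a0; apply/lkerE => u; have := a0 (iota (delta u)).
rewrite -iota_lact graph_lact_delta -(linear0 iota) => /iota_inj.
by move=> /(congr1 (fun v : c00 D => v e)); rewrite delta_in.
Qed.

Lemma c00_sum (u : c00 D) :
  exists s : seq (edge D), u = \sum_(e <- s) delta (u e).
Proof.
have /asboolP/finite_seqP[s sE] := c00_valP u.
exists (undup s); apply: c00_eq => f.
have sum_at (t : seq (edge D)) : uniq t ->
    (\sum_(e <- t) delta (u e)) f = if f \in t then u f else 0.
  elim: t => [|e t IH] /=; first by rewrite big_nil.
  move=> /andP[et ut]; rewrite big_cons in_cons.
  rewrite -[LHS]/(delta (u e) f + (\sum_(j <- t) delta (u j)) f) IH //.
  case: (eqVneq f e) et => [<- /negPf -> /=|fe _ /=].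
    by rewrite delta_in addr0.
  by rewrite delta_out 1?eq_sym // add0r.
rewrite sum_at ?undup_uniq // mem_undup; case: ifP => // /negP fs.
apply: contrapT => uf; apply: fs.
have : [set` s] f by rewrite -sE /=; apply/eqP.
by [].
Qed.

End completed_graph_correspondence.

(** * Tail graphs *)

Lemma full_annihilator (R : realType) (C C' : cstarAlgType R)
    (Y : hilbertModType C) (h : C = C') (Z : hilbertModType C') (x : Z) :
  full_module Y -> (forall y z : Y, ract x (cast_alg h (inner y z)) = 0) ->
  x = 0.
Proof.
move: Z x; case: C' / h => Z x fY xYZ; apply: inner_ract_self_eq0.
have : closure (lspan [set c : C | exists xi eta : Y, c = inner xi eta])
  (inner x x) by rewrite fY.
move=> /closure_cvg[v Sv vc].
have v0 n : ract x (v n) = 0.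
  apply: (@lspan_ind _ _ _ (fun c : C => ract x c = 0) _ _ _ (Sv n)).
    exact: ract0r.
  by move=> k _ c [y [z ->]] c0; rewrite ractDr ractZr xYZ c0 scaler0 addr0.
apply: (cvg_uniq v0) (cvg_cst _).
apply: (@cvg_additive _ _ _ (ract x) `|x|) vc => [c d||c] //.
  exact: ractBr.
exact: norm_ract.
Qed.

Section tail_combinatorics.
Variables (R : realType) (T : tail_graph R).
Local Notation V := (vertex T).
Local Notation E := (edge T).
Local Notation E' := (edge (remove_edge (e0 T))).
Local Notation w := (tail_path T).
Implicit Types (p q : V) (e : E) (f : E').

(** As every vertex receives an edge, f extends to an infinite path; following
    the tail up to f, one obtains an infinite path with range p0. *)
Lemma unique_continuation n f :
  rng (val f) = (if n is n'.+1 then src (val (w n')) else p0 T) -> f = w n.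
Proof.
move=> fn; have [next nextP] := choice (tail_no_sources (t := T)).
pose walk i := iter i (fun h : E' => next (src (val h))) f.
pose path i := if (i < n)%N then w i else walk (i - n)%N.
have [w0 wS] := tail_pathP T.
suff /tail_path_unique E : infinite_path path (p0 T).
  by rewrite -E /path ltnn subnn.
split=> [|i].
  by rewrite /path; case: n fn {path} => [|n] fn //=; exact: fn.
rewrite /path; have [lt_in|le_ni] := ltnP i n; last first.
  rewrite ltnNge (leq_trans le_ni) //= subSn //=; exact: esym (nextP _).
have [lt_i1n|] := ltnP i.+1 n; first exact: wS.
rewrite leq_eqVlt ltnNge lt_in orbF => /eqP E; subst n.
by rewrite subnn /walk /= fn.
Qed.

Lemma rng_p0 e : rng e = p0 T -> e = e0 T \/ e = e1 T.
Proof.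
move=> ep; have [->|ne] := eqVneq e (e0 T); [by left|right].
by rewrite /e1 -(@unique_continuation 0 (exist _ e ne) ep).
Qed.

Lemma src_tail_neq f : src (val f) <> p0 T.
Proof.
by move=> /src_p0 fe; have := valP f; rewrite fe eqxx.
Qed.

Definition nontrivial p : Prop := exists a : valg p, a <> 0.

Definition on_tail p : Prop := exists n, src (val (w n)) = p.

Lemma edge_into p : exists f, rng (val f) = p.
Proof. exact: tail_no_sources. Qed.

Lemma rng_on_tail n : rng (val (w n)) <> p0 T -> on_tail (rng (val (w n))).
Proof.
have [w0 wS] := tail_pathP T; case: n => [|n]; first by move=> /(_ w0).
by move=> _; exists n; exact: wS.
Qed.

Lemma path_exists n p : exists l : seq E',
  size l = n /\ @finite_path (remove_edge (e0 T)) p l.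
Proof.
elim: n p => [|n IH] p; first by exists [::].
have [f fp] := edge_into p; have [l [sl lp]] := IH (src (val f)).
by exists (f :: l); rewrite /= sl; split.
Qed.

(** Every vertex other than p0 reaches the tail along edges of the graph
    without the loop, so that a property of the vertices of the tail which
    passes from the source to the range of an edge holds everywhere. *)
Lemma tail_induction (P : V -> Prop) :
  (forall n, P (src (val (w n)))) ->
  (forall f, rng (val f) <> p0 T -> P (src (val f)) -> P (rng (val f))) ->
  forall p, p <> p0 T -> P p.
Proof.
move=> Pw PE p pp; have [n nP] := tail_accessible pp.
have [l [sl lp]] := path_exists n p.
have {nP sl} := nP l sl lp; elim: l p pp lp => [|f l IH] p pp /=.
  move=> _ [i [|]] /= wi; last first.
    by have <- : src (val (w i)) = p := wi; exact: Pw.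
  have [w0 wS] := tail_pathP T; case: i wi => [|i] wi.
    by case: pp; rewrite -[RHS]w0; exact: esym wi.
  have <- : src (val (w i)) = p := etrans (wS i) wi; exact: Pw.
move=> [fp lp] lw; rewrite -fp; apply: PE; rewrite ?fp //.
by apply: IH => //; exact: src_tail_neq.
Qed.

Section equivalences.
Hypotheses
  (equiv : forall e, e <> e0 T -> e <> e1 T -> equivalence_bimodule (ecorr e))
  (full1 : full_module (ecorr (e1 T))) (nontrivial1 : nontrivial (src (e1 T))).

Lemma full_zero (C : cstarAlgType R) (Y : hilbertModType C) :
  full_module Y -> (forall y : Y, y = 0) -> forall c : C, c = 0.
Proof.
move=> fY Y0 c.
have : closure (lspan [set c : C | exists xi eta : Y, c = inner xi eta]) c.
  by rewrite fY.
move=> /closure_cvg[v Sv vc].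
have v0 n : v n = 0.
  apply: (@lspan_ind _ _ _ (fun c : C => c = 0) _ _ _ (Sv n)) => //.
  by move=> k _ y [x [x' ->]] ->; rewrite (Y0 x) inner0l scaler0 addr0.
by apply: (cvg_uniq v0 vc); exact: cvg_cst.
Qed.

Lemma nontrivial_src e : equivalence_bimodule (ecorr e) ->
  nontrivial (rng e) -> nontrivial (src e).
Proof.
move=> [_ inj _] [a a0]; apply: contrapT => tr; apply: a0.
have C0 (c : valg (src e)) : c = 0.
  by apply: contrapT => c0; apply: tr; exists c.
apply: inj; apply/funext => x; rewrite lact0l.
by apply: inner_eq0; exact: C0.
Qed.

Lemma nontrivial_rng e : equivalence_bimodule (ecorr e) ->
  nontrivial (src e) -> nontrivial (rng e).
Proof.
move=> [fe _ comp] [c c0]; apply: contrapT => tr; apply: c0.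
apply: (full_zero fe) => y; apply: inner_ract_self_eq0.
have : range (lact (ecorr e)) (theta y y) by rewrite comp; exact: theta_compact.
move=> [a _ ay]; have -> : ract y (inner y y) = theta y y y by [].
rewrite -ay (_ : a = 0) ?lact0l //.
by apply: contrapT => a0; apply: tr; exists a.
Qed.

Lemma edge_full f : full_module (ecorr (val f)).
Proof.
have [->//|f1] := eqVneq (val f) (e1 T).
have [] // := equiv _ (elimN eqP f1); exact: elimN eqP (valP f).
Qed.

Lemma equiv_rng f : rng (val f) <> p0 T -> equivalence_bimodule (ecorr (val f)).
Proof.
move=> fp; apply: equiv; first exact: elimN eqP (valP f).
by move=> fe; apply: fp; rewrite fe; case: (tail_pathP T).
Qed.

(** Nonvanishing of the algebras propagates along the equivalence bimodules:
    forward along the tail, then backward from the tail to any vertex. *)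
Lemma nontrivial_vertex p : p <> p0 T -> nontrivial p.
Proof.
apply: tail_induction => [|f fp]; last exact/nontrivial_rng/equiv_rng.
have [w0 wS] := tail_pathP T; elim=> [//|n IH].
have wn : rng (val (w n.+1)) <> p0 T by rewrite -[rng _]wS; exact: src_tail_neq.
by apply: nontrivial_src; [exact: equiv_rng|rewrite -[rng _]wS].
Qed.

End equivalences.

(** If no two edges share a source other than p0, the graph without the loop is
    the line formed by the tail. *)
Lemma line_graph :
  (forall e f : E, src e = src f -> src e <> p0 T -> e = f) ->
  forall p, p <> p0 T ->
    (src (d := T) @^-1` [set p] #= `I_1)%card /\
    (rng (d := T) @^-1` [set p] #= `I_1)%card.
Proof.
move=> inj p pp; have [n np] : on_tail p.
  apply: tail_induction pp => [n|f fp [n nf]]; first by exists n.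
  have fw : f = w n by apply/val_inj/inj; rewrite -?nf //; exact: src_tail_neq.
  by rewrite fw; apply: rng_on_tail; rewrite -fw.
split.
  rewrite (_ : _ @^-1` _ = [set val (w n)]); first exact: card_set1.
  apply/seteqP; split=> [e /= ep|_ -> //]; apply: inj; rewrite ep //.
rewrite (_ : _ @^-1` _ = [set val (w n.+1)]); first exact: card_set1.
have [_ wS] := tail_pathP T; apply/seteqP; split=> [e /= ep|_ -> /=].
  have ne : e != e0 T by apply/eqP => ee; apply: pp; rewrite -ep ee rng_e0.
  by rewrite -(@unique_continuation n.+1 (exist _ e ne)) //= ep np.
by rewrite -np; exact/esym/wS.
Qed.

End tail_combinatorics.

(** * The correspondence with a tail *)

Section tail_bimodule.
Variables (R : realType) (T : tail_graph R).
Local Notation X := (loop_corr T).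
Local Notation X1 := (first_corr T).
Local Notation AG := (graph_algebra T).
Hypotheses
  (equiv : forall e : edge T, e <> e0 T -> e <> e1 T ->
    equivalence_bimodule (ecorr e))
  (X1_is_full : full_module X1)
  (X1_comp : @compact_ops _ _ X1 `<=` range (lact X1))
  (X1_kats : katsura_ideal X `<=` lker X1)
  (X1_ker : lker X1 `<=` annihilator (lker X))
  (X1_lact : lact_compact X1 `<=` lact_compact X)
  (X_noninj : lker X <> [set 0]).
Variables (Y : correspondence AG AG) (iota : {linear c00 T -> Y}).
Hypotheses (iota_inner : forall u v p,
    (inner (iota u) (iota v) : AG) p = graph_inner u v p)
  (iota_dense : dense (range iota))
  (iota_ract : forall u x, iota (graph_ract u x) = ract (iota u) x)
  (iota_lact : forall x u, iota (graph_lact x u) = lact Y x (iota u)).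

Let J0 : ecorr (e0 T) -> X :=
  @cast_vec R _ _ _ _ (congr1 (@valg R T) (rng_e0 T))
    (congr1 (@valg R T) (src_e0 T)) (ecorr (e0 T)).
Let J1 : ecorr (e1 T) -> X1 :=
  @cast_vec R _ _ _ _ (congr1 (@valg R T) (proj1 (tail_pathP T))) erefl
    (ecorr (e1 T)).

Let J0_lact (x : AG) u :
  J0 (lact (ecorr (e0 T)) (x (rng (e0 T))) u) = lact X (x (p0 T)) (J0 u).
Proof. by rewrite (eq_alg_cast (rng_e0 T)) -cast_vec_lact. Qed.
Let J1_lact (x : AG) u :
  J1 (lact (ecorr (e1 T)) (x (rng (e1 T))) u) = lact X1 (x (p0 T)) (J1 u).
Proof. by rewrite (eq_alg_cast (proj1 (tail_pathP T))) -cast_vec_lact. Qed.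
Let J0_theta x y u : J0 (theta x y u) = theta (J0 x) (J0 y) (J0 u).
Proof. by rewrite /theta cast_vec_inner -cast_vec_ract. Qed.
Let J1_theta x y u : J1 (theta x y u) = theta (J1 x) (J1 y) (J1 u).
Proof. by rewrite /theta cast_vec_inner -cast_vec_ract. Qed.

Let ker0 (a : valg (p0 T)) : lker X a -> lker X1 a -> a = 0.
Proof. by move=> Xa X1a; apply: ann_lker_eq0 Xa; exact: X1_ker. Qed.

Let nontrivial1 : nontrivial (src (e1 T)).
Proof.
apply: contrapT => tr; apply: X_noninj.
have C0 (c : valg (src (e1 T))) : c = 0.
  by apply: contrapT => c0; apply: tr; exists c.
have ker1 a : lker X1 a.
  by apply/lkerE => x; apply: (@inner_eq0 _ _ X1); exact: C0.
apply/seteqP; split=> [b Xb /=|_ -> /=]; last exact: lact0l.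
exact/star_mul_eq0/(X1_ker (ker1 (star b))).
Qed.

Let full1 : full_module (ecorr (e1 T)).
Proof. exact: corr_cast_full X1_is_full. Qed.

(** At p0 an element of the kernel acts as zero on X and on X1, and the second
    property makes it orthogonal to the kernel of X; at any other vertex it is
    detected by an equivalence bimodule. *)
Lemma tail_lact_injective a : lker Y a -> a = 0.
Proof.
move=> Ya; have edges e : lker (ecorr e) (a (rng e)).
  exact: (lker_edges iota_inner iota_lact e Ya).
apply: c0_sum_eq => p; have [->|/eqP pp] := eqVneq p (p0 T).
  apply: ker0; apply/lkerE => z.
    have [u ->] := cast_vec_surj z; rewrite -/(J0 u) -J0_lact.
    by have /lkerE -> := edges (e0 T); exact: cast_vec0.
  have [u ->] := cast_vec_surj z; rewrite -/(J1 u) -J1_lact.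
  by have /lkerE -> := edges (e1 T); exact: cast_vec0.
have [f fp] := edge_into p; rewrite -fp.
have [_ inj _] : equivalence_bimodule (ecorr (val f)).
  by apply: equiv_rng => //; rewrite fp.
by apply: inj; rewrite lact0l; exact: edges.
Qed.

Let tail_annihilator (a : AG) : annihilator (lker Y) a.
Proof. by move=> b /tail_lact_injective ->; exact: cmul0r. Qed.

Section necessity.
Hypothesis Y_rep : forall x y : Y, exists a, left_rep x y a.

(** For edges e, f with the same source, the representative of a pair of
    vectors x in X_e and y in X_f acts diagonally but also as x <y, _>, which
    maps X_f to X_e.  So x <y, z> = 0 for all x, y, z unless e = f. *)
Lemma tail_src_inj (e f : edge T) : src e = src f -> src e <> p0 T -> e = f.
Proof.
move=> ef ep; apply: contrapT => /eqP nef.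
have full g : src g <> p0 T -> full_module (ecorr g).
  move=> gp; have ge : g != e0 T.
    by apply/eqP => gE; apply: gp; rewrite gE src_e0.
  exact: (edge_full equiv full1 (exist _ g ge)).
have [c c0] := nontrivial_vertex equiv nontrivial1 ep.
apply: c0; apply: (full_zero (full e ep)) => x.
have fp : src f <> p0 T by rewrite -ef.
apply: (full_annihilator (h := congr1 (@valg R T) (esym ef)) (full f fp)).
move=> y z.
have [a [_ axy]] := Y_rep (iota (delta x)) (iota (delta y)).
have := congr1 (@^~ (iota (delta z))) axy.
rewrite -iota_lact /theta -iota_ract graph_lact_delta graph_ract_delta.
move/(iota_inj iota_inner)/(congr1 (fun v : c00 T => v e)).
rewrite delta_out 1?eq_sym // delta_in => /esym.
by rewrite (inner_delta iota_inner) delta_in (dfwith_cast (esym ef)).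
Qed.

(** The coordinate at p0 of the left inner product of vectors supported on the
    loop is the required value.  It is orthogonal to the kernel of X because
    elements of this kernel, placed at p0, annihilate such vectors. *)
Lemma tail_loop_rep (xi eta : X) : exists a, left_rep xi eta a.
Proof.
have [u ->] := cast_vec_surj xi; have [v ->] := cast_vec_surj eta.
rewrite -/(J0 u) -/(J0 v).
have [b bP] := Y_rep (iota (delta u)) (iota (delta v)); have [_ buv] := bP.
exists (b (p0 T)); split.
  rewrite -[b _]starK; apply: ann_star => k Xk.
  have /left_rep_uniq/(_ (left_rep0 _)) :
      left_rep 0 (iota (delta v)) (point (star k) ** b).
    have := left_rep_lact (point (star k)) bP.
    rewrite -iota_lact graph_lact_delta (_ : lact _ _ u = 0).
      rewrite (_ : delta 0 = 0) ?linear0 //.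
      by apply: c00_eq => f; case: (eqVneq f (e0 T)) => [->|fe];
        rewrite ?delta_in // delta_out // eq_sym.
    apply: (@cast_vec_inj R _ _ _ _ (congr1 (@valg R T) (rng_e0 T))
      (congr1 (@valg R T) (src_e0 T)) (ecorr (e0 T))).
    rewrite -/(J0 _) J0_lact point_in cast_vec0.
    by have /lkerE := lker_star Xk.
  move=> /(congr1 (fun a : AG => a (p0 T))) pb.
  have {}pb : star k ** b (p0 T) = 0.
    by rewrite -[RHS]pb -[RHS]/(_ ** _) point_in.
  by rewrite -(starK k) -starM pb star0.
apply/funext => z; have [w ->] := cast_vec_surj z; rewrite -/(J0 w) -J0_lact.
have := congr1 (@^~ (iota (delta w))) buv.
rewrite -iota_lact /theta -iota_ract graph_lact_delta graph_ract_delta.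
move/(iota_inj iota_inner)/(congr1 (fun v : c00 T => v (e0 T))).
rewrite !delta_in (inner_delta iota_inner) delta_in dfwith_in => ->.
exact: J0_theta.
Qed.

End necessity.

Section sufficiency.
Hypotheses (X_rep : forall xi eta : X, exists a, left_rep xi eta a)
  (one_edge : forall p, p <> p0 T ->
    (src (d := T) @^-1` [set p] #= `I_1)%card /\
    (rng (d := T) @^-1` [set p] #= `I_1)%card).

Let card1_uniq (S : set (edge T)) (e f : edge T) :
  (S #= `I_1)%card -> S e -> S f -> e = f.
Proof.
move=> /eq_cardSP[g _]; rewrite II0 card_eq0 => /eqP S0 Se Sf.
have all_g h : S h -> h = g.
  by move=> Sh; apply: contrapT => hg; have : (S `\ g) h by []; rewrite S0.
by rewrite (all_g e) // (all_g f).
Qed.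

Let src_inj e f : src e = src f -> e = f :> edge T.
Proof.
have [ep|/eqP ep] := eqVneq (src e) (p0 T).
  by move=> /esym; rewrite ep => /src_p0 ->; exact: src_p0.
by move=> ef; apply: card1_uniq (one_edge ep).1 _ _.
Qed.

Let rng_inj e f : rng e = rng f -> rng e <> p0 T -> e = f :> edge T.
Proof. by move=> ef ep; apply: card1_uniq (one_edge ep).2 _ _. Qed.

Let edge_rep e (b : AG) (x y : ecorr e) :
  lact (ecorr e) (b (rng e)) = theta x y ->
  (forall g, g <> e -> lker (ecorr g) (b (rng g))) ->
  left_rep (iota (delta x)) (iota (delta y)) b.
Proof.
move=> bxy other; split; first exact: tail_annihilator.
apply: (lact_theta_delta iota_inner iota_dense iota_ract iota_lact) => v g.
have [->|/eqP ge] := eqVneq g e; first by rewrite delta_in dfwith_in bxy.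
rewrite delta_out 1?eq_sym ?ract0l; last exact/eqP.
by have /lkerE -> := other g ge.
Qed.

Let point_lker (p : vertex T) (g : edge T) (a : valg p) :
  p <> rng g -> lker (ecorr g) (point a (rng g)).
Proof. by move=> /eqP pg; rewrite point_out //; exact: lact0l. Qed.

(** Values of the left inner product lie in the Katsura ideal, which acts as
    zero on X1. *)
Let loop_rep (x y : ecorr (e0 T)) :
  exists b, left_rep (iota (delta x)) (iota (delta y)) b.
Proof.
have [a [Na axy]] := X_rep (J0 x) (J0 y); exists (point a); apply: edge_rep.
  apply/funext => u; apply: (@cast_vec_inj R _ _ _ _
    (congr1 (@valg R T) (rng_e0 T)) (congr1 (@valg R T) (src_e0 T))).
  by rewrite -/(J0 _) -/(J0 _) J0_lact J0_theta point_in axy.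
move=> g g0; have [gp|/eqP gp] := eqVneq (rng g) (p0 T); last first.
  by apply: point_lker => pg; apply: gp.
have [//|->] := rng_p0 gp.
have /lkerE X1a : lker X1 a.
  apply: X1_kats; split=> //.
  by rewrite /lact_compact /= axy; exact: theta_compact.
apply/lkerE => u; apply: (@cast_vec_inj R _ _ _ _
  (congr1 (@valg R T) (proj1 (tail_pathP T))) erefl).
by rewrite -/(J1 _) J1_lact point_in X1a cast_vec0.
Qed.

(** An operator of rank one on X1 is the action of some a, which acts on X as a
    compact operator, hence as an element b of the Katsura ideal; then a - b
    acts as the same operator on X1, and as zero on X. *)
Let first_rep (x y : ecorr (e1 T)) :
  exists b, left_rep (iota (delta x)) (iota (delta y)) b.
Proof.
have [a _ axy] := X1_comp (theta_compact (J1 x) (J1 y)).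
have ca : lact_compact X a.
  by apply: X1_lact; rewrite /lact_compact /= axy; exact: theta_compact.
have [b Xb bE] := compact_lact_katsura X_rep ca.
have Xab : lker X (a - b) by rewrite /lker /= lactB bE subrr.
exists (point (a - b)); apply: edge_rep.
  apply/funext => u; apply: (@cast_vec_inj R _ _ _ _
    (congr1 (@valg R T) (proj1 (tail_pathP T))) erefl).
  rewrite -/(J1 _) -/(J1 _) J1_lact J1_theta point_in lactB axy.
  by rewrite (X1_kats Xb) subr0.
move=> g g1; have [gp|/eqP gp] := eqVneq (rng g) (p0 T); last first.
  by apply: point_lker => pg; apply: gp.
have [->|//] := rng_p0 gp; apply/lkerE => u; apply: (@cast_vec_inj R _ _ _ _
  (congr1 (@valg R T) (rng_e0 T)) (congr1 (@valg R T) (src_e0 T))).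
by rewrite -/(J0 _) J0_lact point_in; have /lkerE -> := Xab; rewrite cast_vec0.
Qed.

(** Distinct edges have distinct sources, so that an operator of rank one from
    one to the other is zero. *)
Let delta_rep e f (x : ecorr e) (y : ecorr f) :
  exists b, left_rep (iota (delta x)) (iota (delta y)) b.
Proof.
have [ef|/eqP ef] := eqVneq e f; last first.
  exists 0; split; first exact: tail_annihilator.
  apply: (lact_theta_delta iota_inner iota_dense iota_ract iota_lact) => v g.
  transitivity (0 : ecorr g).
    by change (lact (ecorr g) 0 (v g) = 0); rewrite lact0l.
  apply: esym.
  have [->|/eqP ge] := eqVneq g e; last first.
    by rewrite delta_out 1?eq_sym ?ract0l //; exact/eqP.
  by rewrite dfwith_out ?ract0r //; apply/eqP => /src_inj/esym.
subst f; have [e_0|/eqP e_0] := eqVneq e (e0 T).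
  by subst e; exact: loop_rep.
have [e_1|/eqP e_1] := eqVneq e (e1 T); first by subst e; exact: first_rep.
have [_ _ comp] := equiv e_0 e_1.
have [a _ axy] : range (lact (ecorr e)) (theta x y).
  by rewrite comp; exact: theta_compact.
exists (point a); apply: edge_rep; first by rewrite point_in.
move=> g ge; apply: point_lker => ge'; apply: ge; apply/esym/rng_inj => //.
by move=> /rng_p0[].
Qed.

Let range_rep u v : exists a, left_rep (iota u) (iota v) a.
Proof.
have sum_rep (w : c00 T) z :
    (forall e (x : ecorr e), exists a, left_rep (iota (delta x)) z a) ->
    exists a, left_rep (iota w) z a.
  move=> dz; have [s ->] := c00_sum w; elim: s => [|e s [a aP]].
    by rewrite big_nil linear0; exists 0; exact: left_rep0.
  have [b bP] := dz e (w e); rewrite big_cons linearD.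
  by exists (1 *: b + a); rewrite -[iota (delta _)]scale1r; exact: left_repP.
apply: (sum_rep u) => e x.
(* Taking adjoints exchanges the two arguments. *)
have [|a av] := sum_rep v (iota (delta x)); last first.
  by exists (star a); exact: left_rep_star.
by move=> f y; exact: delta_rep.
Qed.

Lemma tail_rep (x y : Y) : exists a, left_rep x y a.
Proof.
apply: (left_rep_dense iota_dense) => [_ _ [u _ <-] [v _ <-]|_ c [u _ <-]|].
- by exists (u - v); rewrite ?linearB.
- by exists (graph_ract u c).
- by move=> _ _ [u _ <-] [v _ <-]; exact: range_rep.
Qed.

End sufficiency.

Lemma tail_hilbert_bimodule :
  (hilbert_bimodule Y <-> hilbert_bimodule X /\
     forall p : vertex T, p <> p0 T ->
       ((src (d := T) @^-1` [set p]) #= `I_1)%card /\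
       ((rng (d := T) @^-1` [set p]) #= `I_1)%card) /\
  (hilbert_bimodule Y <-> essential_hilbert_bimodule Y).
Proof.
split; last first.
  split=> [hY|[]//]; split=> //; split; first exact: katsura_closed_ideal.
  apply: katsura_essential; first exact: tail_lact_injective.
  exact/hilbert_bimoduleP.
split=> [/hilbert_bimoduleP Y_rep|[/hilbert_bimoduleP X_rep one]]; last first.
  by apply/hilbert_bimoduleP; exact: tail_rep.
split; first by apply/hilbert_bimoduleP; exact: tail_loop_rep.
by apply: line_graph; exact: tail_src_inj.
Qed.

End tail_bimodule.

Theorem theorem3p1 (R : realType) (A : cstarAlgType R)
    (X : correspondence A A) (X_noninjective : lker X <> [set 0])
    (T : tail X)
    (Xtau : correspondence (graph_algebra T) (graph_algebra T))
    (Xtau_graph : graph_correspondence Xtau) :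
  (hilbert_bimodule Xtau <->
     hilbert_bimodule X /\
     forall p : vertex T, p <> p0 T ->
       ((src (d := T) @^-1` [set p]) #= `I_1)%card /\
       ((rng (d := T) @^-1` [set p]) #= `I_1)%card) /\
  (hilbert_bimodule Xtau <-> essential_hilbert_bimodule Xtau).
Proof.
case: T Xtau Xtau_graph => t hA hX equiv Y1 full comp kats ker cmp Y.
move=> [iota [i1 i2 i3 i4]]; rewrite /= in Y iota i1 i2 i3 i4 *.
move: X X_noninjective hX full comp kats ker cmp; rewrite /Y1; clear Y1.
case: A / hA.
move=> X Xn /= hX; subst X => full comp kats ker cmp.
exact: (tail_hilbert_bimodule equiv full comp kats ker cmp Xn i1 i2 i3 i4).
Qed.
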